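(* Let $K_L$, $s$ and $I$ be as in the context, let $F:\mathcal{H}\to\mathbb{C}[D]$ be smooth and $\Phi_{L,v}^{F,H}(\tau,\zeta):=\downarrow_H\big(\Theta_L(\tau,\zeta;v)\otimes F(\tau)\big)$. Assume that $\Phi_{L,v}^{F,H}(\tau,\zeta+\tau\sigma_{v_+}+\overline\tau\sigma_{v_-}+\nu)=\mathbf{e}\big(-\tau\frac{\sigma_{v_+}^2}{2}-\overline\tau\frac{\sigma_{v_-}^2}{2}-(\sigma,\zeta)\big)\chi_\nu t_\sigma\Phi_{L,v}^{F,H}(\tau,\zeta)$ for all $\tau\in\mathcal{H}$, $\zeta\in L_\mathbb{C}$ and all $\sigma,\nu\in L^*$ with $\sigma+L,\nu+L\in K_L$. Then there is a unique function $G:\mathcal{H}\to\mathbb{C}[\overline{D}]$, $\overline D=I^\perp/I$, with $F=\uparrow_{I}G$, and $\Phi_{L,v}^{F,H}=\mathcal{P}\,\Phi_{L,v}^{G,H'}$, where $\Phi_{L,v}^{G,H'}(\tau,\zeta):=\downarrow_{H'}\big(\Theta_L(\tau,\zeta;v)\otimes G(\tau)\big)$.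
   Context: Discriminant forms: finite abelian groups with a $\mathbb{Q}/\mathbb{Z}$-valued quadratic form $q$ with non-degenerate bilinear form $(\cdot,\cdot)$; $Y^\perp$ orthogonal; isotropic = $q$ vanishes. For isotropic $Y$ in $E$: $\uparrow_Y\mathfrak{e}_\gamma=\sum_{\delta\in Y^\perp,\delta+Y=\gamma}\mathfrak{e}_\delta$ ($\mathbb{C}[Y^\perp/Y]\to\mathbb{C}[E]$) and $\downarrow_Y\mathfrak{e}_\delta=\mathfrak{e}_{\delta+Y}$ if $\delta\in Y^\perp$, else $0$ ($\mathbb{C}[E]\to\mathbb{C}[Y^\perp/Y]$); tensor products $\mathbb{C}[A]\otimes\mathbb{C}[B]=\mathbb{C}[A\oplus B]$. Let $L$ be an even lattice over $\mathbb{Z}$ with bilinear form $(\cdot,\cdot)$, $\lambda^2=(\lambda,\lambda)$, $D_L=L^*/L$; fix $v$: $L_\mathbb{R}=v_+\oplus v_-$ orthogonal, $v_+$ positive and $v_-$ negative definite, $x_{v_\pm}$ $\mathbb{C}$-linear projections; $\Theta_L(\tau,\zeta;v)=\sum_{\gamma\in D_L}\big[\sum_{\lambda\in L+\gamma}\mathbf{e}(\tau\frac{\lambda_{v_+}^2}{2}+\overline\tau\frac{\lambda_{v_-}^2}{2}+(\lambda,\zeta))\big]\mathfrak{e}_\gamma$, $\mathbf{e}(z)=e^{2\pi iz}$. $D$ is a discriminant form, $H\subseteq D_L\oplus D$ isotropic and horizontal ($H\cap D_L=H\cap D=0$), elements $\gamma=(\gamma_L,\gamma_D)$, projections $H_L,H_D$,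 $\Delta_H=H^\perp/H$. $K_L\subseteq D_L$ is a subgroup containing $H_L^\perp$ with a homomorphism $s:K_L\to H^\perp$ such that $s(x)_L=x$, $s(x)=(x,0)$ for $x\in H_L^\perp$, and $x\mapsto s(x)+H$ is injective with $q_{\Delta_H}(s(x)+H)=q_{D_L}(x)$. Then $I:=\{s(x)_D:x\in K_L\}\subseteq D$ is an isotropic subgroup with $I\cap H_D=I\cap H_D^\perp=0$; $I^\perp\subseteq D$, $\overline D=I^\perp/I$. For $\sigma,\nu\in L^*$ with $\sigma+L,\nu+L\in K_L$, the operators on $\mathbb{C}[\Delta_H]$ are $t_\sigma\mathfrak{e}_\beta=\mathfrak{e}_{\beta-(s(\sigma+L)+H)}$ and $\chi_\nu\mathfrak{e}_\beta=\mathbf{e}((s(\nu+L)+H,\beta))\mathfrak{e}_\beta$. Let $H\cap I^\perp:=\{\gamma\in H:\gamma_D\in I^\perp\}$ and $H'$ its (isomorphic) image in $D_L\oplus\overline D$ under $\gamma\mapsto(\gamma_L,\gamma_D+I)$, a horizontal isotropic subgroup, with $\Delta_{H'}=H'^\perp/H'$. For $\beta\in\Delta_H$ with a representative $x\in H^\perp$ having $x_D\in I^\perp$, $p(\beta):=(x_L,x_D+I)+H'\in\Delta_{H'}$ is well defined, and $\mathcal{P}:\mathbb{C}[\Delta_{H'}]\to\mathbb{C}[\Delta_H]$ is $\mathcal{P}\mathfrak{e}_\alpha=\sum_{\beta:\,p(\beta)=\alpha}\mathfrak{e}_\beta$ (in this situation $p$ is a bijection between these sets, so $\mathcal{P}$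 is the map induced by the injection $\iota_{\overline\Delta}$ of the paper). *)

(* Defs.v *)
From HB Require Import structures.
From mathcomp Require Import all_boot all_order all_algebra.
From mathcomp Require Import generic_quotient ring_quotient finalg complex finmap.
From mathcomp Require Import all_classical all_reals all_analysis.
From mathcomp Require Import summability ring.

Set Implicit Arguments.
Unset Strict Implicit.
Unset Printing Implicit Defensive.

Import Order.TTheory GRing.Theory Num.Theory.
Import numFieldNormedType.Exports.

Local Open Scope ring_scope.
Local Open Scope complex_scope.
Local Open Scope quotient_scope.


Definition ratint : {pred rat} := fun x => x \is a Num.int.

Fact ratint_zmod_closed : zmod_closed ratint.
Proof. by split=> [|x y]; rewrite ?inE /ratint ?unfold_in //; apply: rpredB. Qed.

HB.instance Definition _ := GRing.isZmodClosed.Build rat ratint ratint_zmod_closed.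

Definition QZ : Type := Quotient.quot ratint.
HB.instance Definition _ := ZmodQuotient.on QZ.
Definition qz (x : rat) : QZ := \pi_QZ x.


(* A finite abelian group with a Q/Z-valued quadratic form; a discriminant
   form is one that satisfies [qf_nondegenerate] below. *)
HB.mixin Record isFinQuadModule E of FinRing.Zmodule E := {
  qf : E -> QZ;
  qf_quadratic : forall (n : int) (x : E), qf (x *~ n) = qf x *~ (n ^+ 2);
  qf_polar_additive : forall x y z : E,
    qf (x + y + z) - qf (x + y) - qf z =
    (qf (x + z) - qf x - qf z) + (qf (y + z) - qf y - qf z)
}.

#[short(type="finQuadType")]
HB.structure Definition FinQuad := {E of isFinQuadModule E & FinRing.Zmodule E}.

Definition bf (E : finQuadType) (x y : E) : QZ := qf (x + y) - qf x - qf y.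

Definition qf_nondegenerate (E : finQuadType) : Prop :=
  forall x : E, (forall y : E, bf x y = 0) -> x = 0.

Section FinQuadTheory.
Variable E : finQuadType.
Implicit Types x y z : E.

Lemma bfC x y : bf x y = bf y x.
Proof. by rewrite /bf [x + y]addrC addrAC. Qed.

Lemma bfDl x y z : bf (x + y) z = bf x z + bf y z.
Proof. exact: qf_polar_additive. Qed.

Lemma bfBl x y z : bf (x - y) z = bf x z - bf y z.
Proof. by apply: (addIr (bf y z)); rewrite -bfDl !subrK. Qed.

Lemma bf0l z : bf 0 z = 0.
Proof. by rewrite -(subrr (0 : E)) bfBl subrr. Qed.

Lemma qf0 : qf (0 : E) = 0.
Proof. by rewrite -(mulr0z (0 : E)) qf_quadratic expr0n mulr0z. Qed.

Lemma qfN x : qf (- x) = qf x.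
Proof. by rewrite -mulrN1z qf_quadratic sqrrN expr1n. Qed.

Lemma qfD x y : qf (x + y) = qf x + qf y + bf x y.
Proof. by rewrite /bf -[_ - _ - _]addrA -opprD [RHS]addrC subrK. Qed.
End FinQuadTheory.

Section ProdFinQuad.
Variables A B : finQuadType.

HB.instance Definition _ := GRing.Zmodule.on (A * B)%type.

Definition prod_qf (x : A * B) : QZ := qf x.1 + qf x.2.

Fact prod_qf_quadratic (n : int) (x : A * B) :
  prod_qf (x *~ n) = prod_qf x *~ (n ^+ 2).
Proof.
have E1 : (x *~ n).1 = x.1 *~ n by exact: (raddfMz (@fst A B)).
have E2 : (x *~ n).2 = x.2 *~ n by exact: (raddfMz (@snd A B)).
by rewrite /prod_qf E1 E2 !qf_quadratic mulrzDl.
Qed.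

Fact prod_qf_polar_additive (x y z : A * B) :
  prod_qf (x + y + z) - prod_qf (x + y) - prod_qf z =
  (prod_qf (x + z) - prod_qf x - prod_qf z) +
  (prod_qf (y + z) - prod_qf y - prod_qf z).
Proof.
have split_polar u v : prod_qf (u + v) - prod_qf u - prod_qf v =
    bf u.1 v.1 + bf u.2 v.2.
  have -> : prod_qf (u + v) = prod_qf u + prod_qf v + (bf u.1 v.1 + bf u.2 v.2).
    by rewrite /prod_qf /= !qfD addrACA; congr (_ + _); exact: addrACA.
  by rewrite -addrA -opprD addrC addKr.
by rewrite !split_polar /= !bfDl addrACA.
Qed.

HB.instance Definition _ := isFinQuadModule.Build (A * B)%type
  prod_qf_quadratic prod_qf_polar_additive.
End ProdFinQuad.

Section Orthogonal.
Variables (E : finQuadType) (A : {set E}).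

Definition perp : {pred E} := fun x => [forall y in A, bf x y == 0].

Lemma perpP (x : E) : reflect {in A, forall y, bf x y = 0} (x \in perp).
Proof.
by apply: (iffP forall_inP) => h y yA; move: (h y yA) => /eqP.
Qed.

Fact perp_zmod_closed : zmod_closed perp.
Proof.
split=> [|x y /perpP hx /perpP hy]; apply/perpP => z zA; first exact: bf0l.
by rewrite bfBl hx // hy // subrr.
Qed.

HB.instance Definition _ := GRing.isZmodClosed.Build E perp perp_zmod_closed.

Record perpT := PerpT { pval : E; pvalP : pval \in perp }.

HB.instance Definition _ := [isSub for pval].
HB.instance Definition _ := [Finite of perpT by <:].
HB.instance Definition _ := [SubChoice_isSubZmodule of perpT by <:].
End Orthogonal.

Record isoSubgroup (E : finQuadType) := IsoSubgroup {
  iso_set :> {set E};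
  iso_zmod : zmod_closed iso_set;
  iso_qf0 : {in iso_set, forall y, qf y = 0}
}.

Section SubQuotient.
Variables (E : finQuadType) (Y : isoSubgroup E).

Definition iso_in_perp : {pred perpT Y} := fun x => pval x \in (Y : {set E}).

Fact iso_in_perp_zmod_closed : zmod_closed iso_in_perp.
Proof.
have [Y0 YB] := iso_zmod Y.
by split=> [|x y xY yY]; rewrite unfold_in /iso_in_perp /= ?YB.
Qed.

HB.instance Definition _ :=
  GRing.isZmodClosed.Build (perpT Y) iso_in_perp iso_in_perp_zmod_closed.

(* Y^\perp / Y *)
Definition subquot : Type := Quotient.quot iso_in_perp.

HB.instance Definition _ := ZmodQuotient.on subquot.

Definition subclass (x : perpT Y) : subquot := \pi_subquot x.
Definition subrepr (g : subquot) : perpT Y := repr g.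

Fact subreprK : cancel subrepr subclass.
Proof. exact: reprK. Qed.

HB.instance Definition _ := CanIsCountable subreprK.
HB.instance Definition _ := fintype.isFinite.Build subquot
  (pcan_enumP (can_pcan subreprK)).

Definition subquot_qf (g : subquot) : QZ := qf (pval (subrepr g)).

Lemma subclass_eq (x y : perpT Y) :
  (subclass x == subclass y) = (pval x - pval y \in (Y : {set E})).
Proof. by rewrite /subclass -Quotient.idealrBE unfold_in. Qed.

Lemma subquot_qfE (x : perpT Y) : subquot_qf (subclass x) = qf (pval x).
Proof.
have /eqP := subreprK (subclass x); rewrite subclass_eq => hY.
rewrite /subquot_qf -[in LHS](subrK (pval x) (pval (subrepr _))) qfD.
have /perpP hx := pvalP x.
by rewrite (iso_qf0 hY) bfC hx // add0r addr0.
Qed.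

Lemma subclassD (x y : perpT Y) : subclass (x + y) = subclass x + subclass y.
Proof. exact: (raddfD \pi_subquot). Qed.

Lemma subclassMz (x : perpT Y) n : subclass (x *~ n) = subclass x *~ n.
Proof. exact: (raddfMz \pi_subquot). Qed.

Lemma subclass_surj (g : subquot) : exists x, g = subclass x.
Proof. by exists (subrepr g); rewrite subreprK. Qed.

Fact subquot_qf_quadratic (n : int) (g : subquot) :
  subquot_qf (g *~ n) = subquot_qf g *~ (n ^+ 2).
Proof.
have [x ->] := subclass_surj g.
rewrite -subclassMz !subquot_qfE -qf_quadratic; congr qf.
exact: (raddfMz (val : perpT Y -> E)).
Qed.

Fact subquot_qf_polar_additive (x y z : subquot) :
  subquot_qf (x + y + z) - subquot_qf (x + y) - subquot_qf z =
  (subquot_qf (x + z) - subquot_qf x - subquot_qf z) +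
  (subquot_qf (y + z) - subquot_qf y - subquot_qf z).
Proof.
have [x' ->] := subclass_surj x; have [y' ->] := subclass_surj y.
have [z' ->] := subclass_surj z.
by rewrite -!subclassD !subquot_qfE; exact: qf_polar_additive.
Qed.

HB.instance Definition _ := isFinQuadModule.Build subquot
  subquot_qf_quadratic subquot_qf_polar_additive.
End SubQuotient.

(* An even lattice with a chosen Z-basis: L = Z^rk with its Gram matrix. *)
Record evenLattice := EvenLattice {
  rk : nat;
  gram : 'M[int]_rk;
  gram_sym : gram^T = gram;
  gram_even : forall x : 'rV[int]_rk, (2 %| ((x *m gram *m x^T) 0 0)%R)%Z;
  gram_nondeg : \det gram != 0
}.

Definition lform (L : evenLattice) (K : comNzRingType) (x y : 'rV[K]_(rk L)) : K :=
  (x *m map_mx intr (gram L) *m y^T) 0 0.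

Section Dual.
Variable L : evenLattice.
Local Notation n := (rk L).

Definition in_dual : {pred 'rV[rat]_n} := fun x =>
  `[< forall m : 'rV[int]_n, lform x (map_mx intr m) \is a Num.int >].

Lemma lformBl (K : comNzRingType) (x y z : 'rV[K]_n) :
  lform (x - y) z = lform x z - lform y z.
Proof. by rewrite /lform !mulmxBl !mxE. Qed.

Lemma lformDl (K : comNzRingType) (x y z : 'rV[K]_n) :
  lform (x + y) z = lform x z + lform y z.
Proof. by rewrite /lform !mulmxDl !mxE. Qed.

Lemma lformC (K : comNzRingType) (x y : 'rV[K]_n) : lform x y = lform y x.
Proof.
have trE (M : 'M[K]_1) : M 0 0 = M^T 0 0 by rewrite mxE.
by rewrite /lform [LHS]trE !trmx_mul trmxK matrix.map_trmx gram_sym mulmxA.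
Qed.

Lemma lformMz (K : comNzRingType) (x y : 'rV[K]_n) k :
  lform (x *~ k) y = lform x y *~ k.
Proof. by rewrite -scaler_int /lform -!scalemxAl mxE mulrzl. Qed.

Fact in_dual_zmod_closed : zmod_closed in_dual.
Proof.
split=> [|x y /asboolP hx /asboolP hy]; apply/asboolP => m.
  by rewrite -(subrr 0) lformBl subrr rpred0.
by rewrite lformBl rpredB.
Qed.

HB.instance Definition _ :=
  GRing.isZmodClosed.Build 'rV[rat]_n in_dual in_dual_zmod_closed.

Record dualL := Dual { dval : 'rV[rat]_n; dvalP : dval \in in_dual }.

HB.instance Definition _ := [isSub for dval].
HB.instance Definition _ := [Choice of dualL by <:].
HB.instance Definition _ := [SubChoice_isSubZmodule of dualL by <:].

(* L inside L^*: the vectors with integral coordinates. *)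
Definition in_lattice : {pred dualL} := fun x => dval x \is a mxOver Num.int.

Fact in_lattice_zmod_closed : zmod_closed in_lattice.
Proof.
split=> [|x y /mxOverP hx /mxOverP hy]; apply/mxOverP => i j; rewrite !mxE //.
exact: rpredB.
Qed.

HB.instance Definition _ :=
  GRing.isZmodClosed.Build dualL in_lattice in_lattice_zmod_closed.

(* D_L = L^* / L *)
Definition discL : Type := Quotient.quot in_lattice.

HB.instance Definition _ := ZmodQuotient.on discL.

Definition dclass (x : dualL) : discL := \pi_discL x.

Lemma dclass_eq (x y : dualL) :
  (dclass x == dclass y) = (dval x - dval y \is a mxOver Num.int).
Proof. by rewrite /dclass -Quotient.idealrBE unfold_in. Qed.

Lemma dclass_surj (g : discL) : exists x, g = dclass x.
Proof. by exists (repr g); rewrite /dclass reprK. Qed.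

Lemma dclassD (x y : dualL) : dclass (x + y) = dclass x + dclass y.
Proof. exact: (raddfD \pi_discL). Qed.

Lemma dclassMz (x : dualL) k : dclass (x *~ k) = dclass x *~ k.
Proof. exact: (raddfMz \pi_discL). Qed.

Lemma mxOver_intP (x : 'rV[rat]_n) :
  reflect (exists m : 'rV[int]_n, x = map_mx intr m) (x \is a mxOver Num.int).
Proof.
apply: (iffP idP) => [/mxOverP h|[m ->]]; last first.
  by apply/mxOverP => i j; rewrite mxE.
exists (map_mx Num.floor x); apply/matrixP => i j; rewrite !mxE.
by rewrite floorK.
Qed.

Lemma gram_det_dual (x : dualL) :
  (\det (gram L))%:~R *: dval x \is a mxOver Num.int.
Proof.
have /asboolP hx := dvalP x.
have xG : dval x *m map_mx intr (gram L) \is a mxOver Num.int.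
  apply/mxOverP => i j; rewrite !ord1 {i}.
  have := hx (delta_mx 0 j); rewrite /lform map_delta_mx trmx_delta -colE.
  by rewrite mxE.
have -> : (\det (gram L))%:~R *: dval x =
    dval x *m map_mx intr (gram L) *m map_mx intr (\adj (gram L)).
  by rewrite -mulmxA -map_mxM mul_mx_adj map_scalar_mx mul_mx_scalar.
apply/mxOverP => i j; rewrite mxE; apply: rpred_sum => k _; apply: rpredM.
  exact: (mxOverP xG).
by rewrite mxE; exact: intr_int.
Qed.

Let d := `|\det (gram L)|%N.

Fact absz_det_gt0 : (0 < d)%N.
Proof. by rewrite absz_gt0 gram_nondeg. Qed.

Definition disc_code (g : discL) : {ffun 'I_n -> 'I_d} :=
  [ffun i => Ordinal (ltn_pmod
    `|(Num.floor ((\det (gram L))%:~R * dval (repr g) 0 i)%R %% d)%Z|%N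
    absz_det_gt0)].

Lemma disc_code_inj : injective disc_code.
Proof.
move=> g h /ffunP gh; rewrite -(reprK g) -(reprK h); apply/eqP.
rewrite -/(dclass _) -/(dclass _) dclass_eq; apply/mxOverP => i j.
rewrite ord1 {i}; move/(_ j): gh; rewrite !ffunE => /(congr1 val) /=.
set a := repr g; set b := repr h.
have fl (x : dualL) :
    (\det (gram L))%:~R * dval x 0 j =
    (Num.floor ((\det (gram L))%:~R * dval x 0 j))%:~R.
  by have /mxOverP/(_ 0 j) := gram_det_dual x; rewrite mxE => /floorK ->.
have md (e : nat) (m : int) : (0 < e)%N ->
    (`|(m %% e)%Z| %% e)%N = `|(m %% e)%Z|%N /\ 0 <= (m %% e)%Z.
  move=> e_gt0; have e0 : e%:Z != 0 by rewrite -lt0n.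
  split; last exact: modz_ge0.
  by rewrite modn_small // -ltz_nat gez0_abs ?modz_ge0 // ltz_pmod.
have [-> ha] := md d (Num.floor ((\det (gram L))%:~R * dval a 0 j)) absz_det_gt0.
have [-> hb] := md d (Num.floor ((\det (gram L))%:~R * dval b 0 j)) absz_det_gt0.
move=> /(congr1 Posz); rewrite (gez0_abs ha) (gez0_abs hb) => /eqP.
rewrite eqz_mod_dvd dvdzE absz_nat -dvdzE => /dvdzP[q]; rewrite !mxE.
move/(congr1 (intr : int -> rat)); rewrite rmorphB /= -!fl -mulrBr rmorphM /=.
have det0 : (\det (gram L))%:~R != 0 :> rat by rewrite intr_eq0 gram_nondeg.
by rewrite mulrC => /(mulIf det0) ->.
Qed.

Definition disc_decode (c : {ffun 'I_n -> 'I_d}) : option discL :=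
  if pselect (exists g, disc_code g == c) is left e then Some (xchoose e) else None.

Fact disc_codeK : pcancel disc_code disc_decode.
Proof.
move=> g; rewrite /disc_decode; case: pselect => [e|]; last by case; exists g.
by congr Some; apply: disc_code_inj; apply/eqP/(xchooseP e).
Qed.

HB.instance Definition _ := PCanIsCountable disc_codeK.
HB.instance Definition _ := fintype.isFinite.Build discL (pcan_enumP disc_codeK).

Lemma qz_eq (x y : rat) : (qz x == qz y) = (x - y \is a Num.int).
Proof. by rewrite /qz -Quotient.idealrBE. Qed.

Lemma qzB (x y : rat) : qz (x - y) = qz x - qz y.
Proof. exact: (raddfB \pi_QZ). Qed.

Lemma qzD (x y : rat) : qz (x + y) = qz x + qz y.
Proof. exact: (raddfD \pi_QZ). Qed.

Lemma qzMz (x : rat) k : qz (x *~ k) = qz x *~ k.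
Proof. exact: (raddfMz \pi_QZ). Qed.

Definition disc_qf (g : discL) : QZ :=
  qz (lform (dval (repr g)) (dval (repr g)) / 2%:R).

Lemma half_lformD (x y : 'rV[rat]_n) :
  lform (x + y) (x + y) / 2%:R =
  lform x x / 2%:R + lform y y / 2%:R + lform x y.
Proof.
rewrite lformDl (lformC x (x + y)) (lformC y (x + y)) !lformDl (lformC y x).
by field.
Qed.

Lemma disc_qfE (x : dualL) :
  disc_qf (dclass x) = qz (lform (dval x) (dval x) / 2%:R).
Proof.
have /eqP := reprK (dclass x); rewrite -/(dclass _) dclass_eq.
case/mxOver_intP => m hm; apply/eqP; rewrite /disc_qf qz_eq.
rewrite -[dval (repr _)](subrK (dval x)) hm half_lformD addrAC addrK.
apply: rpredD; last by rewrite lformC; have /asboolP := dvalP x.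
have /dvdzP[q hq] := gram_even m.
have -> : lform (map_mx intr m) (map_mx intr m) = (q * 2)%:~R :> rat.
  by rewrite -hq /lform matrix.map_trmx -!map_mxM mxE.
by rewrite rmorphM /= mulfK.
Qed.

Fact disc_qf_quadratic (k : int) (g : discL) :
  disc_qf (g *~ k) = disc_qf g *~ (k ^+ 2).
Proof.
have [x ->] := dclass_surj g; rewrite -dclassMz !disc_qfE -qzMz; congr qz.
have -> : dval (x *~ k) = dval x *~ k by exact: (raddfMz (val : dualL -> 'rV[rat]_n)).
by rewrite lformMz lformC lformMz -mulrzA -expr2 mulrzAl.
Qed.

Fact disc_qf_polar_additive (x y z : discL) :
  disc_qf (x + y + z) - disc_qf (x + y) - disc_qf z =
  (disc_qf (x + z) - disc_qf x - disc_qf z) +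
  (disc_qf (y + z) - disc_qf y - disc_qf z).
Proof.
have polar (u v : dualL) : disc_qf (dclass (u + v)) - disc_qf (dclass u) -
    disc_qf (dclass v) = qz (lform (dval u) (dval v)).
  rewrite !disc_qfE half_lformD -!qzB; congr qz.
  by rewrite -addrA -opprD addrC addKr.
have [x' ->] := dclass_surj x; have [y' ->] := dclass_surj y.
have [z' ->] := dclass_surj z.
by rewrite -!dclassD !polar -qzD -lformDl.
Qed.

HB.instance Definition _ := isFinQuadModule.Build discL
  disc_qf_quadratic disc_qf_polar_additive.

End Dual.

Section GroupAlgebra.
Variable R : realType.

Definition ee (z : R[i]) : R[i] :=
  (expR (- (2%:R * pi * complex.Im z)))%:C *
  (cos (2%:R * pi * complex.Re z) +i* sin (2%:R * pi * complex.Re z)).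

(* e(b) for b in Q/Z does not depend on the chosen representative. *)
Definition eeQZ (b : QZ) : R[i] := ee ((ratr (repr b) : R)%:C).

Definition grpalg (A : finType) := {ffun A -> R[i]}.

Definition ebase (A : finType) (a : A) : grpalg A := [ffun a' => (a' == a)%:R].

Definition gscale (A : finType) (c : R[i]) (f : grpalg A) : grpalg A :=
  [ffun a => c * f a].

Definition linext (A B : finType) (phi : A -> grpalg B) (f : grpalg A) : grpalg B :=
  \sum_(a : A) gscale (f a) (phi a).

(* C[A] (x) C[B] = C[A (+) B] *)
Definition gtensor (A B : finType) (f : grpalg A) (g : grpalg B) : grpalg (A * B)%type :=
  [ffun p => f p.1 * g p.2].

Definition uparrow (E : finQuadType) (Y : isoSubgroup E) :
    grpalg (subquot Y) -> grpalg E :=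
  linext (fun g : subquot Y => \sum_(x : perpT Y | subclass x == g) ebase (pval x)).

Definition downarrow (E : finQuadType) (Y : isoSubgroup E) :
    grpalg E -> grpalg (subquot Y) :=
  linext (fun x : E =>
    if insub x is Some x' then ebase (subclass (x' : perpT Y)) else 0).

Definition uhp := {z : R[i] | 0 < complex.Im z}.

(* Iterated partial derivatives in x (true) and y (false). *)
Fixpoint partials (w : seq bool) (f : R * R -> R) : R * R -> R :=
  if w is b :: w' then
    fun p => 'D_(if b then (1, 0) else (0, 1)) (partials w' f) p
  else f.

Definition smooth_on (U : set (R * R)) (f : R * R -> R) : Prop :=
  forall (w : seq bool) (p : R * R), U p ->
    {for p, continuous (partials w f)} /\
    (forall b : bool, derivable (partials w f) p (if b then (1, 0) else (0, 1))).

(* Extension by 0 of a function on the upper half-plane, in the real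
   coordinates of x + iy. *)
Definition uhp_ext (f : uhp -> R) (p : R * R) : R :=
  if insub (p.1 +i* p.2) is Some t then f t else 0.

Definition smooth (A : finType) (F : uhp -> grpalg A) : Prop :=
  forall a : A,
    smooth_on [set p | 0 < p.2]%classic
      (uhp_ext (fun t => complex.Re (F t a))) /\
    smooth_on [set p | 0 < p.2]%classic
      (uhp_ext (fun t => complex.Im (F t a))).
End GroupAlgebra.

Section Theta.
Variables (R : realType) (L : evenLattice).

Record vsplit := VSplit {
  vpos : {vspace 'rV[R]_(rk L)};
  vneg : {vspace 'rV[R]_(rk L)};
  vsplit_full : (vpos + vneg)%VS = fullv;
  vsplit_direct : directv (vpos + vneg);
  vsplit_orth : forall x y, x \in vpos -> y \in vneg -> lform x y = 0;
  vpos_gt0 : forall x, x \in vpos -> x != 0 -> 0 < lform x x;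
  vneg_lt0 : forall x, x \in vneg -> x != 0 -> lform x x < 0
}.

Definition toR (l : dualL L) : 'rV[R]_(rk L) := map_mx ratr (dval l).
Definition toC (x : 'rV[R]_(rk L)) : 'rV[R[i]]_(rk L) := map_mx (real_complex R) x.

Variable v : vsplit.

Definition proj_pos (x : 'rV[R]_(rk L)) := daddv_pi (vpos v) (vneg v) x.
Definition proj_neg (x : 'rV[R]_(rk L)) := daddv_pi (vneg v) (vpos v) x.

(* tau x_{v_+}^2 / 2 + conj(tau) x_{v_-}^2 / 2 *)
Definition qtau (tau : uhp R) (x : 'rV[R]_(rk L)) : R[i] :=
  val tau * (lform (proj_pos x) (proj_pos x) / 2%:R)%:C +
  conjc (val tau) * (lform (proj_neg x) (proj_neg x) / 2%:R)%:C.

Definition Theta (tau : uhp R) (zeta : 'rV[R[i]]_(rk L)) : grpalg R (discL L) :=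
  [ffun g => summability.sum (fun l : {l : dualL L | dclass l == g} =>
     (ee (qtau tau (toR (val l)) + lform (toC (toR (val l))) zeta) : R[i]^o))].

Definition Phi (D : finQuadType) (H : isoSubgroup (discL L * D)%type)
    (F : uhp R -> grpalg R D) (tau : uhp R) (zeta : 'rV[R[i]]_(rk L)) :
    grpalg R (subquot H) :=
  downarrow H (gtensor (Theta tau zeta) (F tau)).
End Theta.

Section Context.
Variables (L : evenLattice) (D : finQuadType).
Local Notation E := (discL L * D)%type.

Definition horizontal (H : isoSubgroup E) : Prop :=
  (forall x : discL L, (x, 0) \in (H : {set E}) -> x = 0) /\
  (forall y : D, (0, y) \in (H : {set E}) -> y = 0).

Definition projL (H : isoSubgroup E) : {set discL L} :=
  [set x.1 | x in (H : {set E})].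

(* The subgroup K_L together with the homomorphism s : K_L -> H^\perp; the
   values of [sec] outside [KL] are irrelevant. *)
Record KLsection (H : isoSubgroup E) := KLSection {
  KL : {set discL L};
  sec : discL L -> perpT H;
  KL_zmod : zmod_closed KL;
  KL_perp : {subset perp (projL H) <= KL};
  secD : {in KL &, {morph sec : x y / x + y}};
  sec_fst : {in KL, forall x, (pval (sec x)).1 = x};
  sec_perp : {in perp (projL H), forall x, pval (sec x) = (x, 0)};
  sec_inj : {in KL &, injective (fun x => subclass (sec x))};
  sec_qf : {in KL, forall x, qf (subclass (sec x)) = qf x}
}.

Variables (H : isoSubgroup E) (S : KLsection H).

Definition Iset : {set D} := [set (pval (sec S x)).2 | x in KL S].

Lemma secB : {in KL S &, {morph sec S : x y / x - y}}.
Proof.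
have [_ KB] := KL_zmod S.
move=> x y xK yK /=; apply: (addIr (sec S y)); rewrite subrK -secD ?subrK //.
exact: KB.
Qed.

Fact Iset_zmod : zmod_closed Iset.
Proof.
have [K0 KB] := KL_zmod S.
split=> [|_ _ /imsetP[x xK ->] /imsetP[y yK ->]].
  apply/imsetP; exists 0 => //.
  by rewrite -(subrr (0 : discL L)) secB // subrr.
by apply/imsetP; exists (x - y); [exact: KB | rewrite secB].
Qed.

Fact Iset_qf0 : {in Iset, forall y, qf y = 0}.
Proof.
move=> _ /imsetP[x xK ->]; have := sec_qf xK.
rewrite {1}/qf /= subquot_qfE {1}/qf /= /prod_qf sec_fst //.
by move/(canRL (addKr _)) => ->; rewrite addNr.
Qed.

Definition Isub : isoSubgroup D := IsoSubgroup Iset_zmod Iset_qf0.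

Local Notation Dbar := (subquot Isub).

Definition Hprime_set : {set discL L * Dbar} :=
  [set g | [exists x : E, exists z : perpT Isub,
    [&& x \in (H : {set E}), pval z == x.2 & g == (x.1, subclass z)]]].

Lemma Hprime_setP (g : discL L * Dbar) :
  reflect (exists x z, [/\ x \in (H : {set E}), pval z = x.2
                         & g = (x.1, subclass z)])
          (g \in Hprime_set).
Proof.
rewrite inE; apply: (iffP existsP) => [[x /existsP[z /and3P[h1 /eqP h2 /eqP h3]]]|].
  by exists x, z.
by case=> x [z [h1 h2 h3]]; exists x; apply/existsP; exists z; rewrite h1 h2 h3 !eqxx.
Qed.

Fact Hprime_zmod : zmod_closed Hprime_set.
Proof.
have [H0 HB] := iso_zmod H.
split=> [|_ _ /Hprime_setP[x [z [xH zx ->]]] /Hprime_setP[y [t [yH ty ->]]]];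
  apply/Hprime_setP.
  by exists 0, 0; split => //; congr (_, _); exact/esym/(raddf0 \pi_(subquot Isub)).
exists (x - y), (z - t); split; first exact: HB.
  by rewrite /= zx ty.
by congr (_, _); exact/esym/(raddfB \pi_(subquot Isub)).
Qed.

Fact Hprime_qf0 : {in Hprime_set, forall y, qf y = 0}.
Proof.
move=> _ /Hprime_setP[x [z [xH zx ->]]]; rewrite -(iso_qf0 xH).
rewrite {1}/qf /= /prod_qf /= {2}/qf /= subquot_qfE zx.
by [].
Qed.

Definition Hprime : isoSubgroup (discL L * Dbar)%type :=
  IsoSubgroup Hprime_zmod Hprime_qf0.

(* The graph of the partially defined map p, written p(beta) = alpha on paper. *)
Definition prel (beta : subquot H) (alpha : subquot Hprime) : bool :=
  [exists x : perpT H, exists z : perpT Isub, exists y : perpT Hprime,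
    [&& subclass x == beta, pval z == (pval x).2,
        pval y == ((pval x).1, subclass z) & subclass y == alpha]].

Variable R : realType.

Definition Pmap : grpalg R (subquot Hprime) -> grpalg R (subquot H) :=
  linext (fun alpha => \sum_(beta | prel beta alpha) ebase R beta).

Definition tshift (sigma : dualL L) : grpalg R (subquot H) -> grpalg R (subquot H) :=
  linext (fun beta => ebase R (beta - subclass (sec S (dclass sigma)))).

Definition chiop (nu : dualL L) : grpalg R (subquot H) -> grpalg R (subquot H) :=
  linext (fun beta =>
    gscale (eeQZ R (bf (subclass (sec S (dclass nu))) beta)) (ebase R beta)).
End Context.

(* Main.v *)
Require Import Defs.
From HB Require Import structures.
From mathcomp Require Import all_boot all_order all_algebra.
From mathcomp Require Import generic_quotient ring_quotient finalg complex finmap.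
From mathcomp Require Import all_classical all_reals all_analysis.
From mathcomp Require Import summability ring lra.

Set Implicit Arguments.
Unset Strict Implicit.
Unset Printing Implicit Defensive.

Import Order.TTheory GRing.Theory Num.Theory.
Import numFieldNormedType.Exports.

Local Open Scope ring_scope.
Local Open Scope complex_scope.

(* Since H is horizontal, a class b of H^perp / H contains at most one x with a given
   component x_L, and Phi_b is the combination of the theta components Theta_{x_L} with
   the coefficients F_{x_D}, x in b. The components Theta_g(tau, .) are linearly
   independent, being absolutely convergent Fourier series with disjoint supports.
   Comparing coefficients in the transformation law gives F_d = e((i, d)) F_{d + j} for
   i, j in I and those d that occur as some x_D; these are all d, because D_L is
   nondegenerate and H is horizontal. Taking j = 0 shows that F_d vanishes unless d is
   orthogonal to I, and i = 0 that F_d is I-invariant, so F descends to I^perp / I. The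
   last identity is a bijection between the x in b with x_D in I^perp and the elements
   of p(b). *)

Lemma qz_surj (b : QZ) : exists x, b = qz x.
Proof. by exists (repr b); rewrite /qz reprK. Qed.

Lemma qz0 : qz 0 = 0.
Proof. by rewrite -(subrr (0 : rat)) qzB subrr. Qed.

Section Exponential.
Variable R : realType.
Implicit Types (z w : R[i]) (r : R).

Lemma eeD : {morph @ee R : z w / z + w >-> z * w}.
Proof.
move=> [a b] [c d]; rewrite /ee /= !mulrDr opprD expRD cosD sinD.
by apply/eqP; rewrite eq_complex /=; apply/andP; split; apply/eqP; ring.
Qed.

Lemma ee0 : ee 0 = 1 :> R[i].
Proof. by rewrite /ee /= !mulr0 oppr0 expR0 cos0 sin0 mul1r. Qed.

Lemma ee_neq0 z : ee z != 0.
Proof.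
apply/eqP => z0; have := eeD z (- z); rewrite subrr ee0 z0 mul0r => /eqP.
by rewrite oner_eq0.
Qed.

Lemma eeMn z n : ee (z *+ n) = ee z ^+ n.
Proof. by elim: n => [|n IH]; rewrite ?mulr0n ?ee0 // mulrS exprS eeD IH. Qed.

Lemma ee_sum (I : finType) (f : I -> R[i]) : ee (\sum_i f i) = \prod_i ee (f i).
Proof. by apply: (big_morph _ eeD ee0). Qed.

Lemma ee_nat n : ee n%:R = 1 :> R[i].
Proof.
rewrite eeMn; have -> : ee 1 = 1 :> R[i]; last by rewrite expr1n.
by rewrite /ee /= mulr0 oppr0 expR0 mulr1 mul1r mulr_natl cos2pi sin2pi.
Qed.

Lemma ee_int (m : int) : ee m%:~R = 1 :> R[i].
Proof.
case: m => n; first exact: ee_nat.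
rewrite NegzE mulrNz; have := eeD (- n.+1%:~R) n.+1%:~R.
by rewrite addNr ee0 ee_nat mulr1.
Qed.

Lemma normr_ee z : `|ee z| = (expR (- (2%:R * pi * complex.Im z)))%:C.
Proof.
rewrite /ee normrM normc_def /= expr0n addr0 sqrtr_sqr ger0_norm ?expR_ge0 //.
by rewrite normc_def /= cos2Dsin2 sqrtr1 mulr1.
Qed.

Lemma normr_ee_real r : `|ee r%:C| = 1.
Proof. by rewrite normr_ee /= mulr0 oppr0 expR0. Qed.

Lemma cos_2piM_eq1 r : 0 <= r < 1 -> cos (2%:R * pi * r) = 1 -> r = 0.
Proof.
case/andP=> r0 r1; rewrite -mulrA mulr_natl cos_mulr2n cos2sin2 => cosE.
have /eqP : sin (pi * r) ^+ 2 = 0 by lra.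
rewrite sqrf_eq0 => sin0; apply/eqP; move: r0; rewrite le0r => /orP[//|r0].
have /sin_gt0_pi : 0 < pi * r < pi by rewrite mulr_gt0 ?pi_gt0 //= gtr_pMr ?pi_gt0.
by rewrite (eqP sin0) ltxx.
Qed.

Lemma ee_real_eq1 r : (ee r%:C == 1) = (r \is a Num.int).
Proof.
apply/idP/idP => [/eqP e1|/intrP[m ->]]; last by rewrite rmorph_int ee_int.
pose f := r - (Num.floor r)%:~R.
have f01 : 0 <= f < 1.
  by rewrite subr_ge0 ltrBlDl -intrD1 floor_le floorD1_gt.
suff /eqP : f = 0 by rewrite subr_eq0 => /eqP ->; rewrite intr_int.
apply: cos_2piM_eq1 f01 _.
have : ee f%:C = 1 by rewrite rmorphB /= eeD e1 mul1r -rmorphN -mulrNz rmorph_int ee_int.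
by rewrite /ee /= mulr0 oppr0 expR0 mul1r => -[].
Qed.

Lemma eeQZ_qz (x : rat) : eeQZ R (qz x) = ee (ratr x)%:C.
Proof.
rewrite /eeQZ; have /eqP := reprK (qz x); rewrite -/(qz _) qz_eq => /intrP[m xm].
by rewrite -[repr _](subrK x) xm !rmorphD /= eeD ratr_int rmorph_int ee_int mul1r.
Qed.

Lemma eeQZD : {morph eeQZ R : b c / b + c >-> b * c}.
Proof.
move=> b c; have [x ->] := qz_surj b; have [y ->] := qz_surj c.
by rewrite -qzD !eeQZ_qz !rmorphD /= eeD.
Qed.

Lemma eeQZ0 : eeQZ R 0 = 1.
Proof. by rewrite -qz0 eeQZ_qz raddf0 ee0. Qed.

Lemma eeQZ_neq0 (b : QZ) : eeQZ R b != 0.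
Proof. exact: ee_neq0. Qed.

Lemma eeQZ_eq1 (b : QZ) : (eeQZ R b == 1) = (b == 0).
Proof.
have [x ->] := qz_surj b; rewrite eeQZ_qz ee_real_eq1 -qz0 qz_eq subr0.
apply/intrP/intrP => -[m]; last by move=> ->; exists m; rewrite ratr_int.
by rewrite -(ratr_int R) => /fmorph_inj ->; exists m.
Qed.
End Exponential.

Section CharacterSums.
Variable R : realType.

Lemma sum_ee_root_of_unity (N : nat) (k : int) : (0 < N)%N ->
  \sum_(j < N) ee (k%:~R * j%:R / N%:R : R)%:C =
  if (N%:Z %| k)%Z then N%:R else 0.
Proof.
move=> N0; pose q := ee (k%:~R / N%:R : R)%:C.
have N0R : N%:R != 0 :> R by rewrite pnatr_eq0 -lt0n.
have powE (j : 'I_N) : ee (k%:~R * j%:R / N%:R : R)%:C = q ^+ j.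
  by rewrite -eeMn -rmorphMn /= -[in RHS]mulr_natr mulrAC.
have qN : q ^+ N = 1.
  by rewrite -eeMn -rmorphMn /= -mulr_natr divfK // rmorph_int ee_int.
have q1 : (q == 1) = (N%:Z %| k)%Z.
  rewrite ee_real_eq1; apply/intrP/dvdzP => -[m km]; exists m; last first.
    by rewrite km intrM mulfK.
  by apply/eqP; rewrite -(eqr_int R) rmorphM /= -km divfK.
rewrite (eq_bigr _ (fun j _ => powE j)) -q1; case: eqVneq => [->|q_neq1].
  by under eq_bigr do rewrite expr1n; rewrite sumr_const card_ord.
have q1_neq0 : q - 1 != 0 by rewrite subr_eq0.
by apply: (mulfI q1_neq0); rewrite -subrX1 qN subrr mulr0.
Qed.

(* Translating the index by [y] multiplies the sum by [chi y]. *)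
Lemma sum_character_eq0 (K : fieldType) (A : finZmodType) (B : {set A}) (chi : A -> K) :
  zmod_closed B -> {in B &, {morph chi : x y / x + y >-> x * y}} ->
  (exists2 y, y \in B & chi y != 1) -> \sum_(x in B) chi x = 0.
Proof.
move=> [B0 BB] chiD [y yB y1].
have translate : \sum_(x in B) chi x = (\sum_(x in B) chi x) * chi y.
  have addyB x : (x + y \in B) = (x \in B).
    apply/idP/idP => xB; first by rewrite -(addrK y x) BB.
    by rewrite -[y]opprK -[- y]sub0r !BB.
  rewrite [LHS](reindex_inj (addIr y)) mulr_suml.
  by apply: eq_big => x; rewrite addyB // => xB; rewrite chiD.
have chi1 : chi y - 1 != 0 by rewrite subr_eq0.
by apply: (mulIf chi1); rewrite mul0r mulrBr mulr1 -translate subrr.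
Qed.
End CharacterSums.

Section FiniteSetSums.
Variable I : choiceType.
Implicit Types A B : {fset I}.

Lemma big_fsetU_disjoint (V : nmodType) (f : I -> V) A B : [disjoint A & B]%fset ->
  \sum_(i <- (A `|` B)%fset) f i = \sum_(i <- A) f i + \sum_(i <- B) f i.
Proof.
move=> dis; rewrite (big_fsetID _ (mem A)) /=; congr (_ + _);
  apply: eq_fbigl => i; rewrite !inE /= andb_orl ?andbb ?andbN ?orFb.
  by rewrite orb_idr // => /andP[].
by rewrite andb_idr // => iB; apply: contraTN iB; exact: fdisjointP.
Qed.

Lemma ler_sum_fsubset (K : numDomainType) (f : I -> K) A B : (forall i, 0 <= f i) ->
  (A `<=` B)%fset -> \sum_(i <- A) f i <= \sum_(i <- B) f i.
Proof.
move=> f0 AB; rewrite [leRHS](big_fsetID _ (mem A)) /=.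
have -> : [fset i in B | i \in A]%fset = A.
  by apply/fsetP => i; rewrite !inE /= andb_idl // => /(fsubsetP AB).
by rewrite lerDl sumr_ge0.
Qed.
End FiniteSetSums.

Section UnorderedSums.

#[local] Existing Instance totally_filter.

(* A one-constructor wrapper: a definition would unfold to the product underlying
   convergence and acquire spurious implicit arguments. *)
Variant has_sum (K : numFieldType) (I : choiceType) (f : I -> K) (s : K) : Prop :=
  HasSum of ((fun B : {fset I} => \sum_(i <- B) f i : K^o) @ totally --> (s : K^o))%classic.

Section HasSum.
Variables (K : numFieldType) (I : choiceType).
Implicit Types (f g : I -> K) (s t e : K).

Lemma has_sumP f s : has_sum f s <-> forall e, 0 < e ->
  exists A : {fset I}, forall B : {fset I}, (A `<=` B)%fset ->
    `|s - \sum_(i <- B) f i| < e.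
Proof.
split=> [[fs] e e0|fs].
  have /cvgrPdist_lt/(_ e e0)[A _ Ae] := fs.
  by exists A => B AB; exact: Ae.
constructor; apply/cvgrPdist_lt => e e0; have [A Ae] := fs e e0.
by exists A => // B AB; exact: Ae.
Qed.

Lemma has_sum_sum f s : has_sum f s -> summability.sum (f : I -> K^o) = s.
Proof.
case=> fs; apply: cvg_lim => //.
rewrite (_ : partial_sum f = fun B : {fset I} => \sum_(i <- B) f i) //.
by apply/funext => B; rewrite /partial_sum big_seq_fsetE.
Qed.

Lemma eq_has_sum f g s : f =1 g -> has_sum f s -> has_sum g s.
Proof. by move=> /funext ->. Qed.

Lemma has_sumZ c f s : has_sum f s -> has_sum (fun i => c * f i) (c * s).
Proof.
by case=> fs; constructor; under eq_fun do rewrite -mulr_sumr; apply: cvgM (cvg_cst _) fs.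
Qed.

Lemma has_sumD f g s t : has_sum f s -> has_sum g t ->
  has_sum (fun i => f i + g i) (s + t).
Proof.
by move=> [fs] [gt]; constructor; under eq_fun do rewrite big_split /=; exact: cvgD fs gt.
Qed.

Lemma has_sum0 : has_sum (fun _ : I => 0 : K) 0.
Proof. by constructor; under eq_fun do rewrite big1 //; exact: cvg_cst. Qed.

Lemma has_sum_big (J : finType) (F : J -> I -> K) (S : J -> K) :
  (forall j, has_sum (F j) (S j)) -> has_sum (fun i => \sum_j F j i) (\sum_j S j).
Proof.
move=> FS; elim: (index_enum J) => [|j r IH].
  by rewrite big_nil; apply: eq_has_sum has_sum0 => i; rewrite big_nil.
rewrite big_cons; apply: eq_has_sum (has_sumD (FS j) IH) => i.
by rewrite big_cons.
Qed.
End HasSum.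

Lemma has_sum_sub (K : numFieldType) (I : choiceType) (P : pred I) (f : I -> K) (s : K) :
  has_sum (fun i => if P i then f i else 0) s ->
  has_sum (fun i : {i | P i} => f (val i)) s.
Proof.
move=> /has_sumP fs; apply/has_sumP => e e0; have [A Ae] := fs e e0.
exists [fset i in pmap (insub : I -> option {i | P i}) A]%fset => B /fsubsetP AB.
pose valB := [fset val i | i in B]%fset.
have <- : \sum_(i <- (A `|` valB)%fset) (if P i then f i else 0) = \sum_(i <- B) f (val i).
  rewrite -(big_fset_incl _ (fsubsetUr A valB)) => [|i].
    rewrite big_imfset /=; last exact: in2W val_inj.
    by apply: eq_bigr => -[i /= ->].
  rewrite in_fsetU => /orP[iA|->//]; case: ifP => // Pi /imfsetP[]; exists (Sub i Pi) => //.
  by apply: AB; rewrite !inE mem_pmap; apply/mapP; exists i; rewrite ?insubT.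
by apply: Ae; exact: fsubsetUl.
Qed.

Lemma has_sum_reindex (K : numFieldType) (I J : choiceType) (h : I -> J) (h' : J -> I)
    (f : J -> K) (s : K) : cancel h h' -> cancel h' h ->
  has_sum f s -> has_sum (fun i => f (h i)) s.
Proof.
move=> hK h'K /has_sumP fs; apply/has_sumP => e e0.
have [A Ae] := fs e e0; exists [fset h' j | j in A]%fset => B /fsubsetP AB.
rewrite (_ : \sum_(i <- B) f (h i) = \sum_(j <- [fset h i | i in B]%fset) f j).
  apply: Ae; apply/fsubsetP => j jA; rewrite -(h'K j).
  by rewrite in_imfset //= AB // in_imfset.
by rewrite big_imfset //=; exact: in2W (can_inj hK).
Qed.
End UnorderedSums.

Section AbsoluteSummability.

Definition abs_summable (K : numFieldType) (I : choiceType) (f : I -> K) : Prop :=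
  exists M : K, forall B : {fset I}, \sum_(i <- B) `|f i| <= M.

Section NumField.
Variable K : numFieldType.

Lemma abs_summable_le (I : choiceType) (f g : I -> K) :
  (forall i, `|f i| <= `|g i|) -> abs_summable g -> abs_summable f.
Proof. by move=> fg [M gM]; exists M => B; apply: le_trans (gM B); exact: ler_sum. Qed.

Lemma abs_summable_normr (I : choiceType) (f : I -> K) :
  abs_summable f -> abs_summable (fun i => `|f i|).
Proof. by apply: abs_summable_le => i; rewrite normr_id. Qed.

Lemma abs_summableD (I : choiceType) (f g : I -> K) :
  abs_summable f -> abs_summable g -> abs_summable (fun i => f i + g i).
Proof.
move=> [M fM] [N gN]; exists (M + N) => B; apply: le_trans (lerD (fM B) (gN B)).
by rewrite -big_split /=; apply: ler_sum => i _; exact: ler_normD.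
Qed.

Lemma abs_summable_comp (I J : choiceType) (h : I -> J) (f : J -> K) : injective h ->
  abs_summable f -> abs_summable (fun i => f (h i)).
Proof.
move=> h_inj [M fM]; exists M => B; have := fM [fset h i | i in B]%fset.
by rewrite big_imfset //=; exact: in2W h_inj.
Qed.

Lemma abs_summableM (I : choiceType) (c f : I -> K) (M : K) :
  (forall i, `|c i| <= M) -> abs_summable f -> abs_summable (fun i => c i * f i).
Proof.
move=> cM [N fN]; exists (`|M| * N) => B; apply: le_trans (ler_wpM2l (normr_ge0 M) (fN B)).
rewrite mulr_sumr; apply: ler_sum => i _; rewrite normrM ler_wpM2r //.
by apply: le_trans (cM i) _; rewrite ger0_norm // (le_trans _ (cM i)).
Qed.

Lemma abs_summable_prod (m : nat) (J : choiceType) (f : J -> K) : abs_summable f ->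
  abs_summable (fun x : {ffun 'I_m -> J} => \prod_j f (x j)).
Proof.
move=> [M fM]; exists (M ^+ m) => B.
pose C := [fset (x : {ffun 'I_m -> J}) j | x in B, j in 'I_m]%fset.
pose values (c : {ffun 'I_m -> C}) : {ffun 'I_m -> J} := [ffun j => val (c j)].
pose box := [fset values c | c in {ffun 'I_m -> C}]%fset.
have B_box : (B `<=` box)%fset.
  apply/fsubsetP => x xB; have xC j : x j \in C by exact: in_imfset2.
  by apply/imfsetP; exists [ffun j => FSetSub (xC j)] => //; apply/ffunP => j; rewrite !ffunE.
apply: le_trans (ler_sum_fsubset (fun=> normr_ge0 _) B_box) _.
rewrite big_imfset /=; last first.
  by move=> c d _ _ /ffunP cd; apply/ffunP => j; have := cd j; rewrite !ffunE => /val_inj.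
rewrite big_enum /=; under eq_bigr => c _ do (rewrite normr_prod; under eq_bigr do rewrite ffunE).
rewrite -(bigA_distr_bigA (fun _ (c : C) => `|f (val c)|)) /= prodr_const card_ord.
rewrite -(big_seq_fsetE _ C predT (fun y => `|f y|)).
by apply: lerXn2r (fM C); rewrite nnegrE ?sumr_ge0 //; have := fM fset0; rewrite big_seq_fset0.
Qed.
End NumField.

Section Real.
Variables (R : realType) (I : choiceType).
Implicit Type f : I -> R.

Lemma abs_summable_geometric (r : R) : 0 < r < 1 ->
  abs_summable (fun k : int => r ^+ `|k|%N).
Proof.
move=> /andP[r0 r1]; have r_ge0 := ltW r0.
pose G := (1 - r)^-1; exists (G + r * G) => B.
pose N := (\max_(k <- B) `|k|%N).+1.
pose pos := [fset Posz (val k) | k in 'I_N]%fset.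
pose neg := [fset Negz (val k) | k in 'I_N]%fset.
have B_box : (B `<=` pos `|` neg)%fset.
  apply/fsubsetP => k kB; have : (`|k| < N)%N by rewrite ltnS (leq_bigmax_seq _ kB).
  rewrite in_fsetU; case: k kB => k _ kN; apply/orP; [left|right]; apply/imfsetP.
    by exists (Ordinal kN).
  by exists (Ordinal (ltnW kN)).
under eq_bigr do rewrite normrX (ger0_norm r_ge0).
have geometric_le : \sum_(k < N) r ^+ k <= G.
  have := @geometric_le_lim R N 1 r ler01 r0; rewrite ger0_norm // mul1r => /(_ r1).
  rewrite /series /= big_mkord; congr (_ <= _).
  by apply: eq_bigr => k _; rewrite /geometric /= mul1r.
apply: le_trans (ler_sum_fsubset (fun=> exprn_ge0 _ r_ge0) B_box) _.
rewrite big_fsetU_disjoint; last first.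
  by apply/fdisjointP => _ /imfsetP[k _ ->]; apply/imfsetP => -[].
rewrite !big_imfset /= => [|k l _ _ [] /val_inj //|k l _ _ [] /val_inj //].
rewrite !big_enum /= lerD //; under eq_bigr do rewrite exprS.
by rewrite -mulr_sumr ler_wpM2l.
Qed.

Lemma ge0_abs_summable_has_sum f : (forall i, 0 <= f i) -> abs_summable f ->
  exists s, has_sum f s.
Proof.
move=> f0 [M fM]; pose E := [set \sum_(i <- B) f i | B in [set: {fset I}]]%classic.
have supE : has_sup E.
  split; first by exists (\sum_(i <- fset0) f i); exists fset0.
  exists M => _ [B _ <-]; apply: le_trans (fM B).
  by apply: ler_sum => i _; exact: ler_norm.
exists (sup E); apply/has_sumP => e e0.
have [_ [A _ <-] supA] := sup_adherent e0 supE.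
exists A => B AB; have B_sup : \sum_(i <- B) f i <= sup E.
  by apply: ub_le_sup; [case: supE | exists B].
rewrite ger0_norm ?subr_ge0 // ltrBlDr -ltrBlDl.
by apply: (lt_le_trans supA); exact: ler_sum_fsubset.
Qed.

Lemma real_abs_summable_has_sum f : abs_summable f -> exists s, has_sum f s.
Proof.
move=> fM; have normM := abs_summable_normr fM.
have [|s fs] := ge0_abs_summable_has_sum _ (abs_summableD fM normM).
  by move=> i; rewrite -lerBlDr sub0r lerNnormlW.
have [t ft] := ge0_abs_summable_has_sum (fun=> normr_ge0 _) normM.
exists (s + (-1) * t).
apply: eq_has_sum (has_sumD fs (has_sumZ (-1) ft)) => i.
by rewrite mulN1r addrK.
Qed.

Lemma real_abs_summable_tail f e : abs_summable f -> 0 < e ->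
  exists A : {fset I}, forall B : {fset I}, [disjoint A & B]%fset ->
    \sum_(i <- B) `|f i| < e.
Proof.
move=> fM e0; have [s /has_sumP fs] :=
  ge0_abs_summable_has_sum (fun=> normr_ge0 _) (abs_summable_normr fM).
have e2 : 0 < e / 2 by rewrite divr_gt0.
have [A Ae] := fs _ e2; exists A => B disAB.
have := Ae _ (fsubset_refl A); have := Ae _ (fsubsetUl A B).
by rewrite big_fsetU_disjoint // !ltr_norml => /andP[+ _] /andP[_ +]; lra.
Qed.
End Real.

Section Complex.
Variables (R : realType) (I : choiceType).
Implicit Types (f : I -> R[i]) (g : I -> R).

Lemma abs_summable_complex_le f g : (forall i, `|f i| <= (g i)%:C) ->
  abs_summable g -> abs_summable f.
Proof.
move=> fg [M gM]; exists M%:C => B; apply: (@le_trans _ _ (\sum_(i <- B) `|g i|)%:C).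
  by rewrite rmorph_sum ler_sum // => i _; rewrite (le_trans (fg i)) // lecR ler_norm.
by rewrite lecR.
Qed.

Lemma abs_summable_real_le f g : (forall i, `|g i|%:C <= `|f i|) ->
  abs_summable f -> abs_summable g.
Proof.
move=> gf [M fM]; exists (complex.Re M) => B.
have : (\sum_(i <- B) `|g i|)%:C <= M.
  by rewrite rmorph_sum; apply: le_trans (fM B); apply: ler_sum => i _; exact: gf.
by rewrite lecE /= => /andP[].
Qed.

Lemma abs_summable_Re f : abs_summable f -> abs_summable (fun i => complex.Re (f i)).
Proof. by apply: abs_summable_real_le => i; exact: normc_ge_Re. Qed.

Lemma abs_summable_Im f : abs_summable f -> abs_summable (fun i => complex.Im (f i)).
Proof.
apply: abs_summable_real_le => i; rewrite -normrN -ReiNIm.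
by apply: le_trans (normc_ge_Re _) _; rewrite normrM complexiE normCi mulr1.
Qed.

Lemma has_sum_real_complex g s : has_sum g s -> has_sum (fun i => (g i)%:C) s%:C.
Proof.
move=> /has_sumP gs; apply/has_sumP => e; rewrite ltcE /= => /andP[/eqP e_real e0].
have [A Ae] := gs _ e0; exists A => B AB.
rewrite -rmorph_sum -rmorphB normc_def /= expr0n addr0 sqrtr_sqr ltcE /=.
by rewrite e_real eqxx Ae.
Qed.

Lemma abs_summable_has_sum f : abs_summable f -> exists s, has_sum f s.
Proof.
move=> fM; have [a fa] := real_abs_summable_has_sum (abs_summable_Re fM).
have [b fb] := real_abs_summable_has_sum (abs_summable_Im fM).
exists (a%:C + 'i%C * b%:C).
apply: eq_has_sum (has_sumD (has_sum_real_complex fa)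
  (has_sumZ 'i%C (has_sum_real_complex fb))) => i.
by rewrite -complexE.
Qed.

Lemma abs_summable_tail f (e : R[i]) : abs_summable f -> 0 < e ->
  exists A : {fset I}, forall B : {fset I}, [disjoint A & B]%fset ->
    \sum_(i <- B) `|f i| < e.
Proof.
move=> fM; rewrite ltcE /= => /andP[/eqP e_real e0].
have normM := abs_summable_Re (abs_summable_normr fM).
have [A Ae] := real_abs_summable_tail normM e0; exists A => B disAB.
have <- : (complex.Re e)%:C = e by case: e e_real {e0 Ae} => x y /= ->.
have := Ae B disAB; rewrite -ltcR rmorph_sum; congr (_ < _).
apply: eq_bigr => i _; rewrite -[RHS]RRe_real ?normr_real //; congr (_%:C).
by rewrite ger0_norm // -ler0c RRe_real ?normr_real.
Qed.
End Complex.
End AbsoluteSummability.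

Section TorsionPoints.
Variables (R : realType) (n : nat).
Implicit Types (m : {ffun 'I_n -> int}) (x : 'rV[R]_n) (N : nat).

Definition pairing m x : R := \sum_j (m j)%:~R * x 0 j.

Lemma pairingBl m m' x : pairing (m - m') x = pairing m x - pairing m' x.
Proof.
by rewrite /pairing -sumrB; apply: eq_bigr => j _; rewrite !ffunE rmorphB mulrBl.
Qed.

Definition torsion_point N (w : {ffun 'I_n -> 'I_N}) : 'rV[R]_n :=
  \row_j ((w j)%:R / N%:R).

Definition dvd_coords N m : bool := [forall j, (N%:Z %| m j)%Z].

Lemma sum_ee_torsion_points N m : (0 < N)%N ->
  \sum_(w : {ffun 'I_n -> 'I_N}) ee (pairing m (torsion_point w))%:C =
  if dvd_coords N m then N%:R ^+ n else 0.
Proof.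
move=> N0; pose E j (k : 'I_N) := ee ((m j)%:~R * k%:R / N%:R : R)%:C.
transitivity (\sum_(w : {ffun 'I_n -> 'I_N}) \prod_j E j (w j)).
  apply: eq_bigr => w _; rewrite /pairing rmorph_sum ee_sum; apply: eq_bigr => j _.
  by rewrite mxE mulrA.
rewrite -(bigA_distr_bigA E) /= (eq_bigr _ (fun j _ => sum_ee_root_of_unity R (m j) N0)).
case: ifPn => [/forallP Nm|]; last first.
  by rewrite negb_forall => /existsP[j /negbTE Nmj]; rewrite (bigD1 j) //= Nmj mul0r.
by under eq_bigr do rewrite Nm; rewrite prodr_const card_ord.
Qed.

Lemma exists_separating_modulus (I : choiceType) (A : {fset I})
    (f : I -> {ffun 'I_n -> int}) :
  exists2 N, (0 < N)%N & forall i, i \in A -> dvd_coords N (f i) -> f i = 0.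
Proof.
pose K := (\max_(i <- A) \max_j `|f i j|)%N; exists K.+1 => // i iA /forallP Nf.
apply/ffunP => j; rewrite ffunE; apply/eqP; rewrite -absz_eq0.
have fK : (`|f i j| < K.+1)%N.
  rewrite ltnS; apply: leq_trans (leq_bigmax_seq _ iA _) => //.
  exact: (leq_bigmax (F := fun j => `|f i j|%N)).
by have := Nf j; rewrite dvdzE absz_nat; apply: contraLR; rewrite -lt0n => /gtnNdvd ->.
Qed.
End TorsionPoints.

Section FourierSeries.
Variables (R : realType) (n : nat) (I : choiceType).
Variables (freq : I -> {ffun 'I_n -> int}) (a : I -> R[i]).
Hypothesis fourier_eq0 :
  forall x : 'rV[R]_n, has_sum (fun i => a i * ee (pairing (freq i) x)%:C) 0.

Lemma fourier_progression_eq0 (N : nat) (m : {ffun 'I_n -> int}) : (0 < N)%N ->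
  has_sum (fun i => if dvd_coords N (freq i - m) then a i else 0) 0.
Proof.
move=> N0; pose x w := torsion_point R (w : {ffun 'I_n -> 'I_N}).
have := has_sumZ (N%:R ^- n) (has_sum_big (fun w =>
  has_sumZ (ee (- pairing m (x w))%:C) (fourier_eq0 (x w)))).
under eq_bigr do rewrite mulr0.
rewrite big1 // mulr0; apply: eq_has_sum => i.
transitivity (N%:R ^- n * (a i * \sum_w ee (pairing (freq i - m) (x w))%:C)).
  congr (_ * _); rewrite mulr_sumr; apply: eq_bigr => w _.
  by rewrite mulrCA -eeD -rmorphD pairingBl [in RHS]addrC.
rewrite sum_ee_torsion_points //; case: ifP => _; last by rewrite !mulr0.
by rewrite mulrC mulfK // expf_neq0 // pnatr_eq0 -lt0n.
Qed.

(* Every progression through [freq i] sums to zero, and for a suitable modulus all its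
   terms but [a i] lie in the tail of the series. *)
Lemma fourier_coef_eq0 : injective freq -> abs_summable a -> forall i, a i = 0.
Proof.
move=> freq_inj a_sum i; apply/eqP/negPn/negP => ai_neq0.
pose e := `|a i| / 2; have e0 : 0 < e by rewrite divr_gt0 ?normr_gt0.
have [A tailA] := abs_summable_tail a_sum e0.
pose A' := (i |` A)%fset.
have [N N0 sepN] := exists_separating_modulus A' (fun k => freq k - freq i).
pose g k := if dvd_coords N (freq k - freq i) then a k else 0.
have /has_sumP/(_ _ e0)[B sumB] := fourier_progression_eq0 (freq i) N0.
have gA' : \sum_(k <- A') g k = a i.
  rewrite (big_fsetD1 i) ?fset1U1 //= /g ifT; last first.
    by apply/forallP => j; rewrite subrr ffunE dvdz0.
  rewrite big1_fset ?addr0 // => k; rewrite !inE => /andP[/eqP ki kA] _.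
  by case: ifP => // /sepN ki0; case: ki; apply/freq_inj/subr0_eq/ki0; rewrite !inE.
have disA : [disjoint A' & B `\` A']%fset.
  by apply/fdisjointP => k kA'; rewrite in_fsetD kA'.
have small_tail : `|\sum_(k <- (B `\` A')%fset) g k| < e.
  apply: le_lt_trans (tailA _ (fdisjointWl (fsubsetUr _ A) disA)).
  apply: le_trans (ler_norm_sum _ _ _) _.
  by apply: ler_sum => k _; rewrite /g; case: ifP; rewrite ?normr0.
have := sumB _ (fsubsetUr A' B); rewrite sub0r normrN.
rewrite -[(A' `|` B)%fset]fsetD0 -(fsetDv A') -fsetUDl big_fsetU_disjoint // gA'.
move=> small_sum; have := ltrD small_sum small_tail.
rewrite /e -splitr -[X in _ + X]normrN => /(le_lt_trans (ler_normD _ _)).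
by rewrite addrK ltxx.
Qed.
End FourierSeries.

Section LatticeForm.
Variable L : evenLattice.
Local Notation n := (rk L).
Implicit Types l m : dualL L.

Lemma lform0l (K : comNzRingType) (x : 'rV[K]_n) : lform 0 x = 0.
Proof. by rewrite /lform !mul0mx mxE. Qed.

Lemma lformZl (K : comNzRingType) (a : K) (x y : 'rV[K]_n) :
  lform (a *: x) y = a * lform x y.
Proof. by rewrite /lform -!scalemxAl mxE. Qed.

Lemma lformDr (K : comNzRingType) (x y z : 'rV[K]_n) :
  lform x (y + z) = lform x y + lform x z.
Proof. by rewrite lformC lformDl !(lformC x). Qed.

Lemma lformZr (K : comNzRingType) (a : K) (x y : 'rV[K]_n) :
  lform x (a *: y) = a * lform x y.
Proof. by rewrite lformC lformZl lformC. Qed.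

Lemma lform_sqrD (K : comNzRingType) (x y : 'rV[K]_n) :
  lform (x + y) (x + y) = lform x x + lform x y *+ 2 + lform y y.
Proof. by rewrite lformDl !lformDr (lformC y x); ring. Qed.

Lemma lform_map (K K' : comNzRingType) (f : {rmorphism K -> K'}) (x y : 'rV[K]_n) :
  lform (map_mx f x) (map_mx f y) = f (lform x y).
Proof.
have gramE : map_mx intr (gram L) = map_mx f (map_mx intr (gram L)).
  by apply/matrixP => i j; rewrite !mxE rmorph_int.
by rewrite /lform [in LHS]gramE matrix.map_trmx -!map_mxM mxE.
Qed.

Lemma lform_toR (R : realType) l m :
  lform (toR R l) (toR R m) = ratr (lform (dval l) (dval m)).
Proof. exact: lform_map. Qed.

Lemma lform_toC (R : realType) (x y : 'rV[R]_n) :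
  lform (toC x) (toC y) = (lform x y)%:C.
Proof. exact: lform_map. Qed.

Lemma toCD (R : realType) (x y : 'rV[R]_n) : toC (x + y) = toC x + toC y.
Proof. exact: map_mxD. Qed.

Lemma toRD (R : realType) l m : toR R (l + m) = toR R l + toR R m.
Proof. exact: map_mxD. Qed.

Lemma dclass0 : dclass (0 : dualL L) = 0.
Proof. exact: (raddf0 \pi_(discL L))%qT. Qed.

Lemma bf_dclass l m : bf (dclass l) (dclass m) = qz (lform (dval l) (dval m)).
Proof.
rewrite /bf -dclassD -[qf]/(@disc_qf L) !disc_qfE half_lformD -!qzB.
by congr qz; ring.
Qed.

Lemma ee_lform (R : realType) l m :
  ee (lform (toC (toR R l)) (toC (toR R m))) = eeQZ R (bf (dclass l) (dclass m)).
Proof. by rewrite lform_toC lform_toR bf_dclass eeQZ_qz. Qed.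

(* The coordinates of [l] with respect to the basis of [L^*] dual to that of [L]. *)
Definition dual_coord l : {ffun 'I_n -> int} :=
  [ffun j => Num.floor ((dval l *m map_mx intr (gram L)) 0 j)].

Lemma dual_coordE l j :
  (dual_coord l j)%:~R = (dval l *m map_mx intr (gram L)) 0 j.
Proof.
rewrite ffunE floorK //; have /asboolP/(_ (delta_mx 0 j)) := dvalP l.
by rewrite /lform map_delta_mx trmx_delta -colE mxE.
Qed.

Lemma gram_unit : map_mx intr (gram L) \in @unitmx rat n.
Proof. by rewrite unitmxE det_map_mx unitfE intr_eq0 gram_nondeg. Qed.

Lemma dual_coord_inj : injective dual_coord.
Proof.
move=> l m /ffunP coordE; apply: val_inj => /=.
apply: (can_inj (mulmxK gram_unit)); apply/matrixP => i j.
by rewrite !ord1 -!dual_coordE coordE.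
Qed.

Lemma lform_pairing (R : realType) l (x : 'rV[R]_n) :
  lform (toR R l) x = pairing (dual_coord l) x.
Proof.
rewrite /lform mxE; apply: eq_bigr => j _; rewrite [x^T _ _]mxE; congr (_ * _).
rewrite -(ratr_int R) dual_coordE.
have -> : toR R l *m map_mx intr (gram L) =
    map_mx ratr (dval l *m map_mx intr (gram L)).
  by rewrite map_mxM; congr (_ *m _); apply/matrixP => i k; rewrite !mxE rmorph_int.
by rewrite mxE.
Qed.

(* A vector of [L^*] pairing integrally with all of [L^*] lies in [L] because
   the rows of the inverse Gram matrix are in [L^*]. *)
Lemma discL_nondegenerate : qf_nondegenerate (discL L).
Proof.
move=> x; have [l ->] := dclass_surj x => l_orth.
apply/eqP; rewrite -dclass0 dclass_eq subr0; apply/mxOverP => i j; rewrite !ord1.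
pose b : 'rV[rat]_n := delta_mx 0 j *m invmx (map_mx intr (gram L)).
have b_dual : b \in @in_dual L.
  apply/asboolP => m; rewrite /lform /b mulmxKV ?gram_unit //.
  by rewrite -rowE mxE !mxE intr_int.
have := l_orth (dclass (Dual b_dual)); rewrite bf_dclass lformC -qz0 => /eqP.
by rewrite qz_eq subr0 /lform /b mulmxKV ?gram_unit // -rowE !mxE.
Qed.
End LatticeForm.

Section Majorant.
Variables (R : realType) (L : evenLattice) (v : vsplit R L).
Local Notation n := (rk L).
Implicit Types x y : 'rV[R]_n.

Lemma proj_posP x : proj_pos v x \in vpos v.
Proof. exact: memv_pi. Qed.

Lemma proj_negP x : proj_neg v x \in vneg v.
Proof. exact: memv_pi. Qed.

Lemma proj_posD x y : proj_pos v (x + y) = proj_pos v x + proj_pos v y.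
Proof. exact: linearD. Qed.

Lemma proj_negD x y : proj_neg v (x + y) = proj_neg v x + proj_neg v y.
Proof. exact: linearD. Qed.

Lemma addv_proj x : proj_pos v x + proj_neg v x = x.
Proof.
by apply: daddv_pi_add; [exact/directv_addP/vsplit_direct | rewrite vsplit_full memvf].
Qed.

Lemma lform_proj_pos x y : lform x (proj_pos v y) = lform (proj_pos v x) (proj_pos v y).
Proof.
rewrite -{1}(addv_proj x) lformDl [X in _ + X]lformC.
by rewrite (vsplit_orth (proj_posP y) (proj_negP x)) addr0.
Qed.

Lemma lform_proj_neg x y : lform x (proj_neg v y) = lform (proj_neg v x) (proj_neg v y).
Proof.
by rewrite -{1}(addv_proj x) lformDl (vsplit_orth (proj_posP x) (proj_negP y)) add0r.
Qed.

Lemma lform_proj x y : lform x y =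
  lform (proj_pos v x) (proj_pos v y) + lform (proj_neg v x) (proj_neg v y).
Proof. by rewrite -lform_proj_pos -lform_proj_neg -lformDr addv_proj. Qed.

Lemma vpos_ge0 x : x \in vpos v -> 0 <= lform x x.
Proof.
by have [->|x0] := eqVneq x 0; [rewrite lform0l | move=> /vpos_gt0/(_ x0)/ltW].
Qed.

Lemma vneg_le0 x : x \in vneg v -> lform x x <= 0.
Proof.
by have [->|x0] := eqVneq x 0; [rewrite lform0l | move=> /vneg_lt0/(_ x0)/ltW].
Qed.

Definition majorant x : R :=
  lform (proj_pos v x) (proj_pos v x) - lform (proj_neg v x) (proj_neg v x).

Lemma majorant_ge0 x : 0 <= majorant x.
Proof.
rewrite subr_ge0; apply: (@le_trans _ _ 0); first exact/vneg_le0/proj_negP.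
exact/vpos_ge0/proj_posP.
Qed.

(* [lform x y] is the polarization of the majorant at [x] and [y_+ - y_-]. *)
Lemma lform_sqr_le_majorant x y : lform x y ^+ 2 <= majorant x * majorant y.
Proof.
have quadratic_ge0 t : 0 <= majorant x + t * (2 * lform x y) + t ^+ 2 * majorant y.
  have pos_ge0 : 0 <= lform (proj_pos v x + t *: proj_pos v y)
                            (proj_pos v x + t *: proj_pos v y).
    by apply: vpos_ge0; rewrite memvD ?memvZ ?proj_posP.
  have neg_le0 : lform (proj_neg v x - t *: proj_neg v y)
                       (proj_neg v x - t *: proj_neg v y) <= 0.
    by apply: vneg_le0; rewrite memvB ?memvZ ?proj_negP.
  rewrite /majorant (lform_proj x y); move: pos_ge0 neg_le0.
  by rewrite -scaleNr !lform_sqrD !lformZl !lformZr; lra.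
pose p := Poly [:: majorant x; 2 * lform x y; majorant y].
have p_ge0 t : 0 <= p.[t].
  by rewrite horner_Poly /= mul0r add0r; have := quadratic_ge0 t; lra.
have := @deg_le2_poly_ge0 _ p (size_Poly _) p_ge0; rewrite !coefE /=.
by lra.
Qed.

Lemma sum_dual_coord_le_majorant : exists2 C, 0 < C & forall l : dualL L,
  \sum_j (`|dual_coord l j|%N)%:R <= C * majorant (toR R l).
Proof.
pose basis j : 'rV[R]_n := delta_mx 0 j.
have sum_ge0 : 0 <= \sum_j majorant (basis j) by apply: sumr_ge0 => j _; exact: majorant_ge0.
exists (1 + \sum_j majorant (basis j)) => [|l]; first by rewrite ltr_pwDl.
apply: (@le_trans _ _ (\sum_j majorant (basis j) * majorant (toR R l))).
  apply: ler_sum => j _; rewrite mulrC; apply: le_trans (lform_sqr_le_majorant _ _).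
  have -> : lform (toR R l) (basis j) = (dual_coord l j)%:~R.
    rewrite lform_pairing /pairing (bigD1 j) //= big1 => [|k kj].
      by rewrite mxE !eqxx mulr1 addr0.
    by rewrite mxE (negbTE kj) andbF mulr0.
  rewrite -real_normK ?num_real // -intr_norm -abszE -[leRHS]rmorphXn /= ler_nat.
  by case: (`|_|%N) => // k; rewrite leq_pmulr.
by rewrite -mulr_suml ler_wpM2r ?majorant_ge0 // lerDr.
Qed.

Section Tau.
Variable tau : uhp R.

Lemma Im_uhp_gt0 : 0 < complex.Im (val tau).
Proof. exact: (valP tau). Qed.

Lemma qtauD x y : qtau v tau (x + y) = qtau v tau x + qtau v tau y +
  (val tau * (lform x (proj_pos v y))%:C + conjc (val tau) * (lform x (proj_neg v y))%:C).
Proof.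
have half_sqrD z t :
    lform (z + t) (z + t) / 2 = lform z z / 2 + lform t t / 2 + lform z t :> R.
  by rewrite lform_sqrD; field.
rewrite /qtau proj_posD proj_negD lform_proj_pos lform_proj_neg !half_sqrD.
by rewrite !rmorphD /=; ring.
Qed.

Lemma normr_ee_qtau x :
  `|ee (qtau v tau x)| = (expR (- (pi * complex.Im (val tau) * majorant x)))%:C.
Proof.
rewrite normr_ee /qtau /majorant; congr (expR _)%:C; case: (val tau) => a b /=.
by field.
Qed.

Lemma abs_summable_ee_qtau : abs_summable (fun l : dualL L => ee (qtau v tau (toR R l))).
Proof.
have [C C0 coord_le] := sum_dual_coord_le_majorant.
pose a := pi * complex.Im (val tau) / C.
have a0 : 0 < a by rewrite !(divr_gt0, mulr_gt0) ?pi_gt0 ?Im_uhp_gt0.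
pose r := expR (- a); have r01 : 0 < r < 1 by rewrite expR_gt0 expR_lt1 oppr_lt0.
apply: (@abs_summable_complex_le _ _ _ (fun l => \prod_j r ^+ `|dual_coord l j|%N)).
  move=> l; rewrite normr_ee_qtau lecR.
  under eq_bigr do rewrite -expRM_natr.
  rewrite -expR_sum ler_expR -mulr_sumr mulNr lerN2.
  by apply: le_trans (ler_wpM2l (ltW a0) (coord_le l)) _; rewrite mulrA divfK ?gt_eqF.
apply: (abs_summable_comp (f := fun m : {ffun 'I_n -> int} => \prod_j r ^+ `|m j|%N)).
  exact: dual_coord_inj.
exact: abs_summable_prod (abs_summable_geometric r01).
Qed.
End Tau.
End Majorant.

Section ThetaFunction.
Variables (R : realType) (L : evenLattice) (v : vsplit R L) (tau : uhp R).
Local Notation n := (rk L).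
Implicit Types (x : 'rV[R]_n) (zeta : 'rV[R[i]]_n) (k l m : dualL L) (g : discL L).

Definition theta_term zeta l : R[i] :=
  ee (qtau v tau (toR R l) + lform (toC (toR R l)) zeta).

Definition theta_coset zeta g l : R[i] :=
  if dclass l == g then theta_term zeta l else 0.

Lemma Theta_eq zeta g s : has_sum (theta_coset zeta g) s -> Theta v tau zeta g = s.
Proof. by rewrite /Theta ffunE => /has_sum_sub/has_sum_sum. Qed.

Lemma theta_term_real x l :
  theta_term (toC x) l = ee (qtau v tau (toR R l)) * ee (pairing (dual_coord l) x)%:C.
Proof. by rewrite /theta_term eeD lform_toC lform_pairing. Qed.

Lemma Theta_has_sum x g : has_sum (theta_coset (toC x) g) (Theta v tau (toC x) g).
Proof.
have [|s xs] := @abs_summable_has_sum _ _ (theta_coset (toC x) g); last first.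
  by rewrite (Theta_eq xs).
apply: abs_summable_le (abs_summable_ee_qtau v tau) => l; rewrite /theta_coset.
case: ifP => _; last by rewrite normr0 normr_ge0.
by rewrite theta_term_real normrM [X in _ * X]normr_ee_real mulr1.
Qed.

Lemma Theta_translate x l m g :
  Theta v tau (toC x + val tau *: toC (proj_pos v (toR R l))
                     + conjc (val tau) *: toC (proj_neg v (toR R l))
                     + toC (toR R m)) g =
  ee (- qtau v tau (toR R l) - lform (toC (toR R l)) (toC x)) *
    eeQZ R (bf (dclass m) g) * Theta v tau (toC x) (g + dclass l).
Proof.
apply: Theta_eq; set e := ee _.
have shifted := has_sum_reindex (addrK l) (subrK l)
  (has_sumZ (e * eeQZ R (bf (dclass m) g)) (Theta_has_sum x (g + dclass l))).
apply: eq_has_sum shifted => k; rewrite /theta_coset dclassD (inj_eq (addIr _)).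
case: eqP => [<-|_]; last by rewrite mulr0.
rewrite /theta_term /e bfC -ee_lform -!eeD toRD qtauD toCD lformDl.
by rewrite !lformDr !lformZr !lform_toC; congr ee; ring.
Qed.

(* The combination is the Fourier series on [L^*] with coefficients [c (dclass l) e(q_tau l)]. *)
Lemma Theta_independent (c : discL L -> R[i]) :
  (forall x, \sum_g c g * Theta v tau (toC x) g = 0) -> c =1 fun=> 0.
Proof.
move=> c0 g; have [l ->] := dclass_surj g.
pose a m := c (dclass m) * ee (qtau v tau (toR R m)).
have a_summable : abs_summable a.
  apply: (abs_summableM (M := \sum_h `|c h|)) (abs_summable_ee_qtau v tau) => m.
  by rewrite (bigD1 (dclass m)) //= lerDl sumr_ge0.
have a_series x : has_sum (fun m => a m * ee (pairing (dual_coord m) x)%:C) 0.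
  have := has_sum_big (fun h => has_sumZ (c h) (Theta_has_sum x h)).
  rewrite c0; apply: eq_has_sum => m; rewrite (bigD1 (dclass m)) //= /theta_coset eqxx.
  rewrite big1 => [|h /negbTE hm]; last by rewrite eq_sym hm mulr0.
  by rewrite addr0 theta_term_real mulrA.
have /eqP := fourier_coef_eq0 a_series (@dual_coord_inj L) a_summable l.
by rewrite mulf_eq0 (negbTE (ee_neq0 _)) orbF => /eqP.
Qed.

Lemma Theta_free_on (I : finType) (P : pred I) (h : I -> discL L) (c : I -> R[i]) :
  {in P &, injective h} ->
  (forall x, \sum_(i | P i) c i * Theta v tau (toC x) (h i) = 0) ->
  {in P, forall i, c i = 0}.
Proof.
move=> h_inj c0 i Pi.
have indep := @Theta_independent (fun g => \sum_(j | P j && (h j == g)) c j).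
have := indep _ (h i); rewrite (bigD1 i) ?eqxx ?andbT //= big1 ?addr0 => [|j].
  apply=> x; rewrite -[RHS](c0 x) [RHS](partition_big h xpredT) //=.
  by apply: eq_bigr => g _; rewrite mulr_suml; apply: eq_bigr => j /andP[_ /eqP ->].
by move=> /andP[/andP[Pj /eqP hj] /eqP[]]; exact: h_inj.
Qed.
End ThetaFunction.

Section QuadraticModules.
Variables (A B : finQuadType) (Y : isoSubgroup A).

Lemma bf0r (x : A) : bf x 0 = 0.
Proof. by rewrite bfC bf0l. Qed.

Lemma bfDr (x y z : A) : bf x (y + z) = bf x y + bf x z.
Proof. by rewrite bfC bfDl !(bfC x). Qed.

Lemma qf_prod (x : A * B) : qf x = qf x.1 + qf x.2.
Proof. by []. Qed.

Lemma bf_prod (x y : A * B) : bf x y = bf x.1 y.1 + bf x.2 y.2.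
Proof.
apply: (addrI (qf x + qf y)); rewrite -qfD !qf_prod !qfD addrACA; congr (_ + _).
exact: addrACA.
Qed.

Lemma bf_subclass (x y : perpT Y) :
  bf (subclass x) (subclass y) = bf (pval x) (pval y).
Proof. by rewrite /bf -subclassD -[qf in LHS]/(@subquot_qf A Y) !subquot_qfE. Qed.

Lemma subset_isoSubgroup_perp : {subset Y <= perp Y}.
Proof.
move=> x xY; apply/perpP => y yY; have [Y0 YB] := iso_zmod Y.
rewrite /bf !(@iso_qf0 _ Y) ?subrr // -[y]opprK -[- y]sub0r.
by rewrite !YB.
Qed.
End QuadraticModules.

Section HorizontalSubgroups.
Variables (A B : finQuadType) (H : isoSubgroup (A * B)%type).
Hypothesis H_capB : forall y : B, (0, y) \in (H : {set _}) -> y = 0.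

Lemma subclass_fst_inj (b : subquot H) :
  {in [pred x : perpT H | subclass x == b] &, injective (fun x => (pval x).1)}.
Proof.
move=> x y; rewrite !inE => /eqP <- /eqP/esym/eqP; rewrite subclass_eq => xyH xy1.
apply: val_inj; rewrite /= [pval x]surjective_pairing [pval y]surjective_pairing xy1.
congr (_, _); apply/subr0_eq/H_capB; rewrite -(subrr (pval y).1) -{1}xy1.
by rewrite (_ : (_, _) = pval x - pval y).
Qed.

(* Evaluate [\sum_x \sum_(h in H) e((x, h_A) + (d, h_B))] in both orders: summing over [x]
   first leaves only [h = 0], summing over [h] first leaves only the [x] with [(x, d)]
   orthogonal to [H]. *)
Lemma perp_snd_surj (R : realType) : qf_nondegenerate A ->
  forall d : B, exists x : perpT H, (pval x).2 = d.
Proof.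
move=> A_nondeg d; pose chi (x : A) (h : A * B) := eeQZ R (bf (x, d) h).
apply: contrapT => no_x.
have sum_over_H x : \sum_(h in (H : {set _})) chi x h = 0.
  apply: (sum_character_eq0 (iso_zmod H)) => [h h' _ _|].
    by rewrite /chi bfDr eeQZD.
  have : (x, d) \notin perp H by apply/negP => xd; apply: no_x; exists (PerpT xd).
  rewrite unfold_in negb_forall_in => /exists_inP[h hH bh].
  by exists h => //; rewrite eeQZ_eq1.
have sum_over_A h : h \in (H : {set _}) -> h != 0 -> \sum_x chi x h = 0.
  move=> hH h_neq0; have h1_neq0 : h.1 != 0.
    apply: contraNneq h_neq0 => h1; move: hH; rewrite [h]surjective_pairing h1.
    by move=> /H_capB ->.
  have chiE x : chi x h = eeQZ R (bf d h.2) * eeQZ R (bf x h.1).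
    by rewrite /chi bf_prod eeQZD mulrC.
  under eq_bigr do rewrite chiE; rewrite -mulr_sumr.
  rewrite (eq_bigl (mem [set: A])) => [|x]; last by rewrite !inE.
  rewrite sum_character_eq0 ?mulr0 // => [|x y _ _|].
  - by split=> [|x y _ _]; rewrite inE.
  - by rewrite bfDl eeQZD.
  apply: contrapT => h1_orth; case/eqP: h1_neq0; apply: A_nondeg => y.
  apply: contrapT => hy; apply: h1_orth; exists y; rewrite ?inE //.
  by rewrite eeQZ_eq1 bfC; apply/eqP.
have : \sum_x \sum_(h in (H : {set _})) chi x h = 0 by apply: big1.
rewrite exchange_big /= (bigD1 0) /=; last by have [] := iso_zmod H.
rewrite [X in _ + X]big1 ?addr0 => [|h /andP[]]; last exact: sum_over_A.
under eq_bigr do rewrite /chi bf0r eeQZ0.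
by rewrite sumr_const => /eqP; rewrite pnatr_eq0 (cardD1 0).
Qed.
End HorizontalSubgroups.

Section ArrowOperators.
Variables (R : realType) (E : finQuadType) (Y : isoSubgroup E).
Implicit Types (x : perpT Y) (b : subquot Y).

Lemma linextE (A B : finType) (phi : A -> grpalg R B) (f : grpalg R A) c :
  linext phi f c = \sum_a f a * phi a c.
Proof. by rewrite /linext sum_ffunE; apply: eq_bigr => a _; rewrite ffunE. Qed.

Lemma sum_mul_delta (A : finType) (f : A -> R[i]) a : \sum_c f c * (c == a)%:R = f a.
Proof.
rewrite (bigD1 a) //= eqxx mulr1 big1 ?addr0 // => c /negbTE ->.
by rewrite mulr0.
Qed.

Lemma sum_ebaseE (A : finType) (P : pred A) (a : A) :
  (\sum_(c | P c) ebase R c) a = (P a)%:R.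
Proof.
rewrite sum_ffunE -[RHS](sum_mul_delta (fun c => (P c)%:R)) big_mkcond.
by apply: eq_bigr => c _; rewrite ffunE eq_sym; case: (P c); rewrite ?mul1r ?mul0r.
Qed.

Lemma sum_perpT (f : E -> R[i]) : {in [predC perp Y], forall p, f p = 0} ->
  \sum_p f p = \sum_(x : perpT Y) f (pval x).
Proof.
move=> f0; rewrite (bigID (mem (perp Y))) /= [X in _ + X]big1 ?addr0 => [|p]; last exact: f0.
rewrite (reindex_omap (@pval E Y) insub) => [|p pY]; last by rewrite insubT.
by apply: eq_bigl => x; rewrite valK eqxx pvalP.
Qed.

Lemma downarrowE (f : grpalg R E) b :
  downarrow Y f b = \sum_(x | subclass x == b) f (pval x).
Proof.
rewrite linextE sum_perpT => [|p /negbTE pY]; last first.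
  by rewrite insubF // ffunE mulr0.
rewrite [RHS]big_mkcond; apply: eq_bigr => x _; rewrite valK ffunE eq_sym.
by case: eqP; rewrite ?mulr1 ?mulr0.
Qed.

Lemma uparrow_pval (g : grpalg R (subquot Y)) x : uparrow g (pval x) = g (subclass x).
Proof.
rewrite linextE -[RHS]sum_mul_delta; apply: eq_bigr => b _; congr (_ * _).
rewrite sum_ffunE [LHS]big_mkcond (bigD1 x) //= ffunE eqxx big1 => [|y /negbTE yx].
  by rewrite addr0 [b == _]eq_sym; case: eqP.
by rewrite ffunE (inj_eq val_inj) [x == y]eq_sym yx; case: ifP.
Qed.

Lemma uparrow_notin (g : grpalg R (subquot Y)) :
  {in [predC perp Y], forall p, uparrow g p = 0}.
Proof.
move=> p pY; rewrite linextE big1 // => b _; rewrite sum_ffunE big1 ?mulr0 // => y _.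
by rewrite ffunE; case: eqP => // py; case/negP: pY; rewrite py; exact: pvalP.
Qed.

Lemma uparrow_inj : injective (@uparrow R E Y).
Proof.
move=> g g' gg'; apply/ffunP => b; have [x ->] := subclass_surj b.
by rewrite -!uparrow_pval gg'.
Qed.

Definition descend (f : grpalg R E) : grpalg R (subquot Y) :=
  [ffun b => f (pval (subrepr b))].

Lemma uparrow_descend (f : grpalg R E) : {in [predC perp Y], forall p, f p = 0} ->
  {in Y, forall y p, f (p + y) = f p} -> uparrow (descend f) = f.
Proof.
move=> f0 f_inv; apply/ffunP => p; have [pY|pY] := boolP (p \in perp Y); last first.
  by rewrite uparrow_notin ?f0.
rewrite -[p]/(pval (PerpT pY)) uparrow_pval ffunE.
have /eqP := subreprK (subclass (PerpT pY)); rewrite subclass_eq => reprY.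
by rewrite -[RHS](f_inv _ reprY) addrC subrK.
Qed.
End ArrowOperators.

Section Projection.
Variables (R : realType) (L : evenLattice) (D : finQuadType).
Variables (H : isoSubgroup (discL L * D)%type) (S : KLsection H).
Implicit Types (x : perpT H) (t : perpT (Isub S)) (z : perpT (Hprime S)).

Lemma perp_Hprime x t : pval t = (pval x).2 -> ((pval x).1, subclass t) \in perp (Hprime S).
Proof.
move=> tx; apply/perpP => _ /Hprime_setP[h [u [hH uh ->]]].
rewrite bf_prod /= bf_subclass tx uh -bf_prod.
by have /perpP := pvalP x; apply.
Qed.

Lemma prelP (b : subquot H) z : reflect
  (exists x t, [/\ subclass x = b, pval t = (pval x).2 & pval z = ((pval x).1, subclass t)])
  (prel b (subclass z)).
Proof.
apply: (iffP existsP) => [[x /existsP[t /existsP[z' /and4P[]]]]|[x [t [<- tx zx]]]]; last first.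
  exists x; apply/existsP; exists t; apply/existsP; exists z.
  by rewrite eqxx tx zx !eqxx.
move=> /eqP xb /eqP tx /eqP z'x; rewrite eq_sym subclass_eq z'x.
case/Hprime_setP => h [u [hH uh [zh1 zh2]]].
exists (x + PerpT (subset_isoSubgroup_perp hH)), (t + u); split.
- by apply/eqP; rewrite -xb subclass_eq /= addrAC subrr add0r.
- by rewrite /= tx uh.
rewrite [pval z]surjective_pairing subclassD /=; congr (_, _).
  by rewrite -zh1 addrC subrK.
by rewrite -zh2 addrC subrK.
Qed.

Lemma Pmap_downarrow (f : grpalg R (discL L * subquot (Isub S))%type) b :
  Pmap (downarrow (Hprime S) f) b = \sum_(z | prel b (subclass z)) f (pval z).
Proof.
rewrite linextE [RHS](partition_big (@subclass _ _) (prel b)) //= [RHS]big_mkcond.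
apply: eq_bigr => a _; rewrite sum_ebaseE mulr_natr mulrb; case: ifP => // ba.
by rewrite downarrowE; apply: eq_bigl => z; case: eqP => [->|]; rewrite ?ba ?andbF.
Qed.

Hypothesis H_hor : horizontal H.

Lemma downarrow_tensor_uparrow (T : grpalg R (discL L)) (g : grpalg R (subquot (Isub S))) :
  downarrow H (gtensor T (uparrow g)) = Pmap (downarrow (Hprime S) (gtensor T g)).
Proof.
apply/ffunP => b; rewrite downarrowE Pmap_downarrow.
pose A := [set x | (subclass x == b) && ((pval x).2 \in perp (Isub S))].
pose descendI x : perpT (Isub S) := insubd 0 (pval x).2.
pose p x : perpT (Hprime S) := insubd 0 ((pval x).1, subclass (descendI x)).
have descendIE x : x \in A -> pval (descendI x) = (pval x).2.
  by rewrite inE => /andP[_ xI]; exact: insubdK.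
have pE x : x \in A -> pval (p x) = ((pval x).1, subclass (descendI x)).
  by move=> /descendIE xI; apply/insubdK/perp_Hprime.
have p_inj : {in A &, injective p}.
  move=> x y xA yA /(congr1 (fun z => (pval z).1)); rewrite !pE //=.
  by move: xA yA; rewrite !inE => /andP[xb _] /andP[yb _]; exact: (subclass_fst_inj H_hor.2 xb yb).
transitivity (\sum_(x in A) T (pval (p x)).1 * g (pval (p x)).2).
  rewrite (bigID (fun x => (pval x).2 \in perp (Isub S))) /= [X in _ + X]big1 ?addr0.
    apply: eq_big => [x|x xbI]; first by rewrite inE.
    have xA : x \in A by rewrite inE.
    by rewrite ffunE pE //= -(descendIE x xA) uparrow_pval.
  by move=> x /andP[_ xI]; rewrite ffunE uparrow_notin ?mulr0.
rewrite -(big_imset (fun z => T (pval z).1 * g (pval z).2) p_inj).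
apply: eq_big => z; last by rewrite ffunE.
apply/imsetP/prelP => [[x xA ->]|[x [t [xb tx zx]]]].
  by exists x, (descendI x); rewrite pE // descendIE //; move: xA; rewrite inE => /andP[/eqP].
have xA : x \in A by rewrite inE xb eqxx -tx pvalP.
exists x => //; apply: val_inj; rewrite /= pE // zx; congr (_, subclass _).
by apply: val_inj; rewrite /= descendIE.
Qed.
End Projection.

Section Transformation.
Variables (R : realType) (L : evenLattice) (v : vsplit R L) (D : finQuadType).
Variables (H : isoSubgroup (discL L * D)%type) (H_hor : horizontal H).
Variables (S : KLsection H) (F : uhp R -> grpalg R D).
Implicit Types (x : perpT H) (b : subquot H) (sigma nu : dualL L) (y : 'rV[R]_(rk L)).

Lemma tshiftE sigma (f : grpalg R (subquot H)) b :
  tshift S sigma f b = f (b + subclass (sec S (dclass sigma))).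
Proof.
rewrite linextE -[RHS]sum_mul_delta; apply: eq_bigr => c _.
by rewrite ffunE eq_sym subr_eq.
Qed.

Lemma chiopE nu (f : grpalg R (subquot H)) b :
  chiop S nu f b = eeQZ R (bf (subclass (sec S (dclass nu))) b) * f b.
Proof.
rewrite linextE mulrC -[RHS](sum_mul_delta (fun c => f c * eeQZ R (bf _ c))).
by apply: eq_bigr => c _; rewrite !ffunE eq_sym mulrA.
Qed.

Lemma PhiE tau zeta b : Phi v H F tau zeta b =
  \sum_(x | subclass x == b) F tau (pval x).2 * Theta v tau zeta (pval x).1.
Proof. by rewrite /Phi downarrowE; apply: eq_bigr => x _; rewrite ffunE mulrC. Qed.

Lemma Phi_theta_relation tau zeta zeta' b b' (c : R[i]) (u : discL L -> R[i])
    (h : discL L -> discL L) :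
  (forall g, Theta v tau zeta g = u g * Theta v tau zeta' (h g)) ->
  Phi v H F tau zeta b = c * Phi v H F tau zeta' b' ->
  \sum_(x | subclass x == b)
    F tau (pval x).2 * (u (pval x).1 * Theta v tau zeta' (h (pval x).1)) =
  c * \sum_(x | subclass x == b') F tau (pval x).2 * Theta v tau zeta' (pval x).1.
Proof.
move=> Theta_rel Phi_rel; transitivity (Phi v H F tau zeta b).
  apply: etrans (esym (PhiE _ _ _)); apply: eq_bigr => x _; congr (_ * _).
  exact/esym/Theta_rel.
by apply: etrans Phi_rel _; congr (_ * _); exact: PhiE.
Qed.

Hypothesis F_trans : forall (tau : uhp R) (zeta : 'rV[R[i]]_(rk L)) sigma nu,
    dclass sigma \in KL S -> dclass nu \in KL S ->
    Phi v H F tau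
      (zeta + val tau *: toC (proj_pos v (toR R sigma))
            + conjc (val tau) *: toC (proj_neg v (toR R sigma))
            + toC (toR R nu)) =
    gscale (ee (- qtau v tau (toR R sigma) - lform (toC (toR R sigma)) zeta))
      (chiop S nu (tshift S sigma (Phi v H F tau zeta))).

(* Both sides are the coefficient of Theta_{x_L + sigma} in the transformation law for the
   class of [x], up to the common exponential factor. *)
Lemma F_coef_translate tau sigma nu x : dclass sigma \in KL S -> dclass nu \in KL S ->
  eeQZ R (bf (dclass nu) (pval x).1) * F tau (pval x).2 =
  eeQZ R (bf (subclass (sec S (dclass nu))) (subclass x)) *
    F tau (pval (x + sec S (dclass sigma))).2.
Proof.
move=> sigmaK nuK; pose b := subclass x; pose s := sec S (dclass sigma).
pose u g := eeQZ R (bf (dclass nu) g).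
pose a := eeQZ R (bf (subclass (sec S (dclass nu))) b).
pose c x' := u (pval x').1 * F tau (pval x').2 - a * F tau (pval (x' + s)).2.
have shift_inj : {in [pred x' | subclass x' == b] &,
    injective (fun x' => (pval x').1 + dclass sigma)}.
  by move=> x1 x2 x1b x2b /addIr; exact: (subclass_fst_inj H_hor.2 x1b x2b).
suff : c x = 0 by move/subr0_eq.
apply: (Theta_free_on shift_inj (v := v) (tau := tau)) (eqxx b) => y.
pose e := ee (- qtau v tau (toR R sigma) - lform (toC (toR R sigma)) (toC y)).
have Phi_b := congr1 (fun f : grpalg R _ => f b) (F_trans tau (toC y) sigmaK nuK).
rewrite /= [RHS]ffunE [X in _ = _ * X]chiopE [X in _ = _ * (_ * X)]tshiftE mulrA in Phi_b.
have := Phi_theta_relation (Theta_translate v tau y sigma nu) Phi_b.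
rewrite -/e -/a; move: (Theta v tau (toC y)) => T.
under eq_bigr do rewrite -mulrA mulrCA.
rewrite -mulr_sumr -mulrA => /(mulfI (ee_neq0 _)).
rewrite [X in _ = _ * X](reindex_inj (addIr s)) /= mulr_sumr => /eqP.
under [X in _ == X]eq_bigl do rewrite subclassD (inj_eq (addIr _)).
rewrite -subr_eq0 -sumrB => /eqP; apply: etrans; apply: eq_bigr => x' _.
by rewrite /c /= sec_fst // /u; ring.
Qed.

Lemma F_twisted_invariant tau :
  {in Isub S &, forall i j d, F tau d = eeQZ R (bf i d) * F tau (d + j)}.
Proof.
move=> _ _ /imsetP[k kK ->] /imsetP[m mK ->] d.
have [nu kE] := dclass_surj k; have [sigma mE] := dclass_surj m.
rewrite {k}kE in kK *; rewrite {m}mE in mK *.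
have [x <-] := perp_snd_surj H_hor.2 R (@discL_nondegenerate L) d.
have := F_coef_translate tau x mK kK.
by rewrite bf_subclass bf_prod sec_fst // eeQZD -mulrA => /(mulfI (eeQZ_neq0 _ _)).
Qed.

Lemma F_supported tau : {in [predC perp (Isub S)], forall d, F tau d = 0}.
Proof.
move=> d; rewrite inE unfold_in negb_forall_in => /exists_inP[i iI].
have [I0 _] := Iset_zmod S; rewrite -(eeQZ_eq1 R) bfC => id_neq1; apply/eqP.
have /eqP := F_twisted_invariant tau iI I0 d; rewrite addr0 eq_sym -subr_eq0.
by rewrite -{2}[F tau d]mul1r -mulrBl mulf_eq0 subr_eq0 (negbTE id_neq1).
Qed.

Lemma F_invariant tau : {in Isub S, forall j d, F tau (d + j) = F tau d}.
Proof.
move=> j jI d; have [I0 _] := Iset_zmod S.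
by rewrite [RHS](F_twisted_invariant tau I0 jI d) bf0l eeQZ0 mul1r.
Qed.
End Transformation.

Theorem theorem5p15 (R : realType) (L : evenLattice) (v : vsplit R L)
  (D : finQuadType) (D_nondeg : qf_nondegenerate D)
  (H : isoSubgroup (discL L * D)%type) (H_hor : horizontal H)
  (S : KLsection H)
  (F : uhp R -> grpalg R D) (F_smooth : smooth F)
  (F_trans : forall (tau : uhp R) (zeta : 'rV[R[i]]_(rk L)) (sigma nu : dualL L),
    dclass sigma \in KL S -> dclass nu \in KL S ->
    Phi v H F tau
      (zeta + val tau *: toC (proj_pos v (toR R sigma))
            + conjc (val tau) *: toC (proj_neg v (toR R sigma))
            + toC (toR R nu)) =
    gscale (ee (- qtau v tau (toR R sigma) - lform (toC (toR R sigma)) zeta))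
      (chiop S nu (tshift S sigma (Phi v H F tau zeta)))) :
  exists G : uhp R -> grpalg R (subquot (Isub S)),
    [/\ forall tau, F tau = uparrow (G tau),
        forall G' : uhp R -> grpalg R (subquot (Isub S)),
          (forall tau, F tau = uparrow (G' tau)) -> G' = G
      & forall tau zeta,
          Phi v H F tau zeta = Pmap (Phi v (Hprime S) G tau zeta)].
Proof.
pose G tau := descend (Isub S) (F tau).
have FE tau : F tau = uparrow (G tau).
  rewrite uparrow_descend //; first exact: (F_supported H_hor F_trans).
  exact: (F_invariant H_hor F_trans).
exists G; split=> // [G' FG'|tau zeta].
  by apply/funext => tau; apply: uparrow_inj; rewrite -FE -FG'.
by rewrite /Phi FE; exact: downarrow_tensor_uparrow.
Qed.
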